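(* Let $(\xi,J)$ be a Markov additive process with $\xi$ nondecreasing, with Bernstein matrix $\mathbf\Phi$, whose Markov chain of types is irreducible and whose position component is not a.s. constant. Let $I_\xi=\int_0^\infty e^{-\xi_t}\,dt$ and, for $k\ge0$, let $\mathbf N(k)$ be the column vector with entries $(\mathbf N(k))_i=\mathbb E_i[I_\xi^k]$, $i\in[K]$. (i) For every integer $k\ge0$, $$\mathbf N(k)=k!\left(\prod_{l=0}^{k-1}\big(\mathbf\Phi(k-l)\big)^{-1}\right)\mathbf 1,$$ where the product is ordered as $(\mathbf\Phi(k))^{-1}(\mathbf\Phi(k-1))^{-1}\cdots(\mathbf\Phi(1))^{-1}$. (ii) For all $a<\rho\big(\lim_{k\to\infty}(\mathbf\Phi(k))^{-1}\big)$, where $\rho$ denotes the spectral radius of a matrix, we have $\mathbb E_i[e^{aI_\xi}]<\infty$ for all $i\in[K]$.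
   Context: Fix $K\in\mathbb N$, $[K]=\{1,\dots,K\}$. A Markov additive process (MAP) is a Markov process $((\xi_t,J_t),t\ge0)$ on $\mathbb R\times[K]\cup\{(+\infty,0)\}$, with law $\mathbb P_{(x,i)}$ when started at $(x,i)$, such that for all $t$ and $(x,i)$, under $\mathbb P_{(x,i)}$, conditionally on $(\xi_u,J_u)_{u\le t}$ and $\xi_t<\infty$, the process $((\xi_{t+s}-\xi_t,J_{t+s}),s\ge0)$ has law $\mathbb P_{(0,J_t)}$, and $(+\infty,0)$ is absorbing. $\mathbb P_i=\mathbb P_{(0,i)}$, with expectation $\mathbb E_i$; by convention $e^{-\infty}=0$. A MAP with $\xi$ nondecreasing is characterised by: the transition rate matrix $\mathbf\Lambda=(\lambda_{i,j})$ of the chain $J$ (before killing); probability distributions $B_{i,j}$ on $[0,\infty)$ (law of the jump of $\xi$ when $J$ jumps from $i$ to $j$, $B_{i,i}=\delta_0$), with $\widehat B_{i,j}(p)=\int_0^\infty e^{-px}B_{i,j}(dx)$; and triplets $(k^{(i)},c^{(i)},\Pi^{(i)})$ (killing rate, drift, L\'evy measure with $\int_{(0,\infty)}(1\wedge x)\Pi^{(i)}(dx)<\infty$) of the subordinator followed by $\xi$ while $J=i$, with Laplace exponent $\psi_i(p)=k^{(i)}+c^{(i)}p+\int_0^\infty(1-e^{-px})\Pi^{(i)}(dx)$. The Bernstein matrix is $\mathbf\Phi(p)=\mathrm{diag}(\psi_i(p))_{i\in[K]}-\big(\lambda_{i,j}\widehat B_{i,j}(p)\big)_{i,j\in[K]}$;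 it satisfies $\mathbb E_i[e^{-p\xi_t}\mathbf 1_{\{J_t=j\}}]=(e^{-t\mathbf\Phi(p)})_{i,j}$ for $p\ge0$. $\mathbf 1$ is the column vector with all entries $1$.
   Formalization: In (ii) the range a < ρ(lim Φ(k)^{-1}) is replaced by a·ρ(lim Φ(k)^{-1}) < 1, since the printed range fails (K=1, ξ killed at rate 1/2 with no drift or jumps, a=1: ρ=2 but E[e^{I_ξ}]=∞). *)

(* Defs.v *)
From HB Require Import structures.
From mathcomp Require Import all_boot all_order all_algebra.
From mathcomp.real_closed Require Import complex.
From mathcomp Require Import all_classical all_reals all_analysis measurable_realfun.

Set Implicit Arguments.
Unset Strict Implicit.
Unset Printing Implicit Defensive.
Import Order.TTheory GRing.Theory Num.Theory.
Import numFieldNormedType.Exports.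
Local Open Scope classical_set_scope.
Local Open Scope ring_scope.

(* [Some i] is the type i; [None] is the label 0 of the cemetery state. *)
Definition phase (K : nat) : Type := option 'I_K.

HB.instance Definition _ (K : nat) := Choice.on (phase K).
HB.instance Definition _ (K : nat) := isPointed.Build (phase K) None.
HB.instance Definition _ (K : nat) := @isMeasurable.Build default_measure_display
  (phase K) (@discrete_measurable (phase K)) (@discrete_measurable0 (phase K))
  (@discrete_measurableC (phase K)) (@discrete_measurableU (phase K)).

(* The sigma-algebra on [T] generated by the maps [X t], for [t] in [D]. *)
Definition sigma_of {R : realType} {d' : measure_display} {S : measurableType d'}
    {T : Type} (X : R -> T -> S) (D : set R) : set (set T) :=
  <<s \bigcup_(t in D) preimage_set_system setT (X t) measurable >>.

Section matrices.
Context {R : realType} {n : nat}.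
Implicit Type A : 'M[R]_n.

Definition expmx A : 'M[R]_n := limn (series (fun k => k`!%:R^-1 *: A ^+ k)).

Definition spectral_radius A : R :=
  sup [set Normc.normc z | z in
    [set z : R[i] | eigenvalue (map_mx (real_complex R) A) z]].

End matrices.

Section markov_additive_processes.
Context {R : realType} {K : nat} {d : measure_display} {Omega : measurableType d}.
Implicit Types (xi : R -> Omega -> \bar R) (J : R -> Omega -> phase K).
Implicit Types P : R -> 'I_K -> probability Omega R.

Local Notation state := (\bar R * phase K)%type.

Definition joint xi J (t : R) (w : Omega) : state := (xi t w, J t w).

Definition increments xi J (t : R) (w : Omega) (s : R) : state :=
  ((xi (t + s)%R w - xi t w)%E, J (t + s) w).

(* The product sigma-algebra on the space of trajectories; only the times
   t >= 0 are observed. *)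
Definition path_events : set (set (R -> state)) :=
  sigma_of (fun t (f : R -> state) => f t) `[0, +oo[.

(* [P x i] is the law started at (x, i). In [map_markov_additive], [A] ranges
   over the past of time t; as J_t takes finitely many values, the conditional
   law given the past is identified on each event {J_t = j}, and the union of
   these events is {xi_t < +oo}. *)
Record is_MAP P xi J : Prop := {
  map_measurable : forall t : R, 0 <= t -> measurable_fun setT (joint xi J t);
  map_finite : forall (t : R) w, 0 <= t -> J t w <> None -> xi t w \is a fin_num;
  map_cemetery : forall (t : R) w, 0 <= t -> J t w = None -> xi t w = +oo%E;
  map_absorbing : forall (s t : R) w, 0 <= s -> s <= t -> J s w = None -> J t w = None;
  map_start : forall (x : R) i, P x i [set w | joint xi J 0 w = (x%:E, Some i)] = 1%E;
  map_markov_additive : forall (x : R) i (t : R) A C j, 0 <= t ->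
    sigma_of (joint xi J) `[0, t] A -> path_events C ->
    P x i (A `&` [set w | J t w = Some j] `&` [set w | C (increments xi J t w)])
    = (P x i (A `&` [set w | J t w = Some j]) *
       P 0%R j [set w | C (fun s => joint xi J s w)])%E }.

Definition nondecreasing_position xi : Prop :=
  forall (s t : R) w, 0 <= s -> s <= t -> (xi s w <= xi t w)%E.

Definition as_constant_position P xi : Prop :=
  forall i, {ae P 0 i, forall w, forall t : R, 0 <= t -> xi t w = xi 0 w}.

(* The integrand uses the convention exp(-oo) = 0, built in [expeR]. *)
Definition exp_functional xi (w : Omega) : \bar R :=
  (\int[lebesgue_measure]_(t in `[0%R, +oo[) expeR (- xi t w))%E.

End markov_additive_processes.

Record characteristics (R : realType) (K : nat) := Characteristics {
  rate : 'M[R]_K;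
  jump : 'I_K -> 'I_K -> probability (measurableTypeR R) R;
  kill : 'I_K -> R;
  drift : 'I_K -> R;
  levy : 'I_K -> {measure set (measurableTypeR R) -> \bar R} }.

Section characteristics.
Context {R : realType} {K : nat}.
Implicit Type ch : characteristics R K.

Record admissible ch : Prop := {
  rate_ge0 : forall i j : 'I_K, i != j -> 0 <= rate ch i j;
  rate_sum0 : forall i, \sum_j rate ch i j = 0;
  jump_support : forall i j, jump ch i j [set x : R | x < 0] = 0%E;
  jump_diag : forall i (A : set (measurableTypeR R)), measurable A ->
    jump ch i i A = \d_(0 : R) A;
  kill_ge0 : forall i, 0 <= kill ch i;
  drift_ge0 : forall i, 0 <= drift ch i;
  levy_support : forall i, levy ch i [set x : R | x <= 0] = 0%E;
  levy_integrable : forall i,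
    (\int[levy ch i]_(x in `]0%R, +oo[) (Num.min 1 x)%:E < +oo)%E }.

Definition irreducible_types ch : Prop :=
  forall i j, connect [rel a b | 0 < rate ch a b] i j.

Definition jump_laplace ch (i j : 'I_K) (p : R) : R :=
  (\int[jump ch i j]_(x in `[0, +oo[) expR (- (p * x)))%R.

Definition laplace_exponent ch (i : 'I_K) (p : R) : R :=
  kill ch i + drift ch i * p +
  (\int[levy ch i]_(x in `]0, +oo[) (1 - expR (- (p * x))))%R.

Definition bernstein ch (p : R) : 'M[R]_K :=
  diag_mx (\row_i laplace_exponent ch i p) -
  \matrix_(i, j) (rate ch i j * jump_laplace ch i j p).

(* Together with [is_MAP], this identity determines the law of the process;
   conversely the law determines [bernstein ch], hence the rates, the jump laws
   of the transitions with positive rate, and the triplets. *)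
Definition has_characteristics {d : measure_display} {Omega : measurableType d}
    (P : R -> 'I_K -> probability Omega R) (xi : R -> Omega -> \bar R)
    (J : R -> Omega -> phase K) ch : Prop :=
  forall (p t : R) (i j : 'I_K), 0 <= p -> 0 <= t ->
  (\int[P 0%R i]_(w in [set w | J t w = Some j]) expeR (- (p%:E * xi t w)) =
   (expmx (- t *: bernstein ch p) i j)%:E)%E.

End characteristics.

(* Main.v *)
Require Import Defs.
From mathcomp Require Import all_boot all_order all_algebra.
From mathcomp.real_closed Require Import complex.
From mathcomp Require Import all_classical all_reals all_analysis measurable_realfun.
From mathcomp Require Import ring lra.
Set Implicit Arguments.
Unset Strict Implicit.
Unset Printing Implicit Defensive.
Import Order.TTheory GRing.Theory Num.Theory.
Import numFieldNormedType.Exports.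
Local Open Scope classical_set_scope.
Local Open Scope ring_scope.

(** Write I for the exponential functional and N(k) for the vector of its
    moments.  The classical argument differentiates I_t = int_t^oo e^(-xi_s) ds
    and integrates over t the Markov property at time t.  Here the time axis is
    discretised instead, which replaces every integral over time by a finite
    sum.  For a step h > 0, let S_h = h * sum_n e^(-xi_(n h)) be the left Riemann
    sum of I.  Since xi is nondecreasing and starts at 0, I <= S_h <= I + h
    ([exp_functional_le_limit], [limit_le_exp_functional]), whence also the
    measurability of I.

    The Markov additive property at the single time h gives
    S_h = h + e^(-xi_h) S'_h, where S'_h is distributed as S_h under P_j on the
    event J_h = j ([riemannS], [markov_moment]).  Expanding the k-th power yields
      M(k) = sum_(l <= k) C(k,l) h^(k-l) e^(-h Phi(l)) M(l)
    for the moments M(l) of S_h, with the identity in place of e^(-h Phi(0))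
    ([moment_rec], [vlimit_rec]).  Moving the term l = k to the left, dividing by
    h and letting h tend to 0 gives Phi(k) N(k) = k N(k-1) ([vfunctional_rec]),
    which is (i) once Phi(k) is known to be invertible and N(k) to be finite.

    Both facts come from one maximum principle for matrices with nonpositive
    off-diagonal entries ([Zmatrix_mono]).  That Phi(k) has this sign pattern,
    has nonnegative row sums and is entrywise nondecreasing in k is read off
    from e^(-t Phi(k)) = (E_i[e^(-k xi_t); J_t = j]) as t tends to 0; its row
    sums cannot all vanish, since then e^(-t Phi(k)) would preserve the vector
    1 and xi would be constant ([conservative_constant]); irreducibility then
    lets every phase reach a row with positive sum.  So Phi(k)^(-1) exists
    and is nonnegative and entrywise nonincreasing in k, hence it converges.
    For small h the same principle applies to 1 - e^(-h Phi(k)), and bounds the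
    moments of the partial sums of S_h uniformly ([functional_moment_fin]).

    For (ii), let L be the limit of Phi(k)^(-1) and let a > 0 with
    a rho(L) < 1.  There is a vector v > 0 with a L v < v
    ([subinvariant_vector]): following t from 0 to a, the matrix 1 - t L cannot
    become singular, as 1/t would then be an eigenvalue of L exceeding rho(L),
    so the maximum principle keeps holding.  By convergence
    a Phi(k)^(-1) v <= theta v for some theta < 1 and all large k, so
    a^k N(k) / k! = a^k Phi(k)^(-1) ... Phi(1)^(-1) 1 decays geometrically
    ([geometric_bound]), and these are the terms of the series for E[e^(a I)]. *)

(** * Maximum principle for matrices with nonpositive off-diagonal entries *)

Section Z_matrices.
Context {R : realFieldType} {n : nat}.
Implicit Types (M : 'M[R]_n) (v x : 'cV[R]_n).

Definition Zmatrix M := forall i j, i != j -> M i j <= 0.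

(** For v = 1, a chained form of weak diagonal dominance: from every index, a path
    of negative entries leads to a row in which the dominance is strict. *)
Definition dominated M v :=
  [/\ forall i, 0 < v i 0, forall i, 0 <= (M *m v) i 0 &
      forall i, exists2 j, connect [rel a b | M a b < 0] i j
                         & 0 < (M *m v) j 0].

Lemma dominated_pos M v : (forall i, 0 < v i 0) ->
  (forall i, 0 < (M *m v) i 0) -> dominated M v.
Proof.
move=> v0 Mv0; split=> // i; first exact: ltW.
by exists i; rewrite ?connect0.
Qed.

(** Maximum principle.  At an index where x / v is minimal with value c < 0, the
    vector y = x - c v is nonnegative and vanishes, so (M y) there is a sum of
    nonpositive terms, while M y >= - c M v >= 0.  Hence M v vanishes there and y
    vanishes at all neighbours; the zero set of y spreads along paths up to a
    strict row, where M v > 0 is a contradiction. *)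
Lemma Zmatrix_mono M v x : Zmatrix M -> dominated M v ->
  (forall i, 0 <= (M *m x) i 0) -> forall i, 0 <= x i 0.
Proof.
move=> MZ [v0 Mv0 con] Mx0 i0; rewrite leNgt; apply/negP => xi0.
pose F i := x i 0 / v i 0.
have [i _ imin] := @Order.TotalTheory.arg_minP _ _ _ i0 xpredT F isT.
set c := F i in imin.
have c0 : c < 0.
  by apply: (le_lt_trans (imin i0 isT)); rewrite /F pmulr_llt0 ?invr_gt0.
pose y := x - c *: v.
have y0 j : 0 <= y j 0.
  have := imin j isT; rewrite /F ler_pdivlMr// !mxE; lra.
have yi : y i 0 = 0.
  by rewrite !mxE /c /F divfK ?subrr// gt_eqF.
have My j : - c * (M *m v) j 0 <= (M *m y) j 0.
  by rewrite mulmxBr -scalemxAr !mxE; have := Mx0 j; rewrite !mxE; lra.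
(* Propagation: the zero set of y avoids strict rows and contains all
   neighbours of its elements. *)
have step a : y a 0 = 0 ->
    (M *m v) a 0 = 0 /\ forall b, M a b < 0 -> y b 0 = 0.
  move=> ya.
  have neg b : M a b * y b 0 <= 0.
    have [->|ab] := eqVneq b a; first by rewrite ya mulr0.
    by rewrite mulr_le0_ge0// MZ// eq_sym.
  have Mya : (M *m y) a 0 = \sum_b M a b * y b 0 by rewrite mxE.
  have Mya0 : (M *m y) a 0 = 0.
    apply/eqP; rewrite eq_le {1}Mya sumr_le0//=.
    by apply: le_trans (My a); rewrite mulr_ge0 ?oppr_ge0 ?(ltW c0).
  split.
    have := My a; have := Mv0 a; rewrite Mya0 => ? H.
    apply/eqP; rewrite eq_le; apply/andP; split=> //.
    by rewrite -(@pmulr_rle0 _ (- c)) ?oppr_gt0 //.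
  move=> b ab; apply/eqP; rewrite -[_ == _]/(y b 0 == 0).
  have /eqP : \sum_b - (M a b * y b 0) = 0.
    by rewrite sumrN -Mya Mya0 oppr0.
  rewrite psumr_eq0; last by move=> ? _; rewrite oppr_ge0.
  move=> /allP/(_ b (mem_index_enum _)).
  by rewrite oppr_eq0 mulf_eq0 lt_eqF.
have [j ij Mvj] := con i.
suff yj : y j 0 = 0 by have [E _] := step _ yj; rewrite E ltxx in Mvj.
case/connectP: ij => p + ->.
have walk q a : y a 0 = 0 -> path [rel a b | M a b < 0] a q -> y (last a q) 0 = 0.
  by elim: q a => //= b q IH a /step[_ ya] /andP[/ya/IH].
exact: walk.
Qed.

Lemma Zmatrix_unit M v : Zmatrix M -> dominated M v -> M \in unitmx.
Proof.
move=> MZ Mv; rewrite -unitmx_tr -row_free_unit -kermx_eq0; apply/eqP/row_matrixP.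
move=> i; rewrite row0; set u := row i _.
have uM : M *m u^T = 0.
  apply: trmx_inj; rewrite trmx_mul trmxK trmx0; apply/eqP.
  by rewrite -sub_kermx row_sub.
apply/rowP => j; apply/eqP; rewrite mxE eq_le.
have null_ge0 x : M *m x = 0 -> 0 <= x j 0.
  by move=> Mx; apply: (Zmatrix_mono MZ Mv) => k; rewrite Mx mxE.
have := null_ge0 _ uM; have := null_ge0 (- u^T); rewrite mulmxN uM oppr0.
by rewrite !mxE oppr_ge0 => -> // ->.
Qed.

Lemma Zmatrix_inv_ge0 M v : Zmatrix M -> dominated M v ->
  forall i j, 0 <= invmx M i j.
Proof.
move=> MZ Mv i j.
have := @Zmatrix_mono M v (col j (invmx M)) MZ Mv _ i.
rewrite mxE; apply=> k.
by rewrite colE mulmxA mulmxV ?(Zmatrix_unit MZ Mv)// mul1mx !mxE ler0n.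
Qed.
End Z_matrices.

(** * Limits of matrices and the matrix exponential *)

Section matrix_limits.
Context {R : realType}.

Lemma cvg_mx m n (u : nat -> 'M[R]_(m, n)) (l : 'M[R]_(m, n)) :
  (forall i j, u k i j @[k --> \oo] --> l i j) -> u @ \oo --> l.
Proof.
move=> ul; apply/cvg_mx_entourageP => A entA.
have H i j : \forall k \near \oo, (l i j, u k i j) \in A.
  have /cvg_app_entourageP/(_ _ entA) := ul i j.
  by apply: filterS => k; rewrite inE.
by apply: filter_forall => i; apply: filter_forall => j; exact: H.
Qed.

Lemma cvg_mx_entry m n (u : nat -> 'M[R]_(m, n)) (l : 'M[R]_(m, n)) i j :
  u @ \oo --> l -> u k i j @[k --> \oo] --> l i j.
Proof. by move=> ul A /(@coord_continuous R m n i j l)/ul. Qed.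

Lemma cvgn_unique (V : normedModType R) (u : nat -> V) (a b : V) :
  u @ \oo --> a -> u @ \oo --> b -> a = b.
Proof. by move=> ua ub; exact: (@cvg_unique _ (@norm_hausdorff _ V) _ _ _ _ ua ub). Qed.

Lemma cvg_sum_fin (I : finType) (u : I -> nat -> R) (l : I -> R) :
  (forall i, u i k @[k --> \oo] --> l i) ->
  (\sum_i u i k) @[k --> \oo] --> \sum_i l i.
Proof. by move=> ul; apply: cvg_big => // x; exact: add_continuous. Qed.

Lemma cvg_harmonicM (c : R) : n.+1%:R^-1 * c @[n --> \oo] --> (0 : R).
Proof.
rewrite -[X in _ --> X](mul0r c).
by apply: cvgM; [exact: cvg_harmonic|exact: cvg_cst].
Qed.

(** The form in which every limit h = 1/(n+1) -> 0 of a scalar is taken. *)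
Lemma cvg_of_dist (u : nat -> R) (l C : R) :
  (forall n, `|u n - l| <= n.+1%:R^-1 * C) -> u n @[n --> \oo] --> l.
Proof.
move=> ul.
apply: (@squeeze_cvgr _ _ _ _ (fun n => l - n.+1%:R^-1 * C) (fun n => l + n.+1%:R^-1 * C)).
- by apply: nearW => n; have := ul n; rewrite ler_distl.
- by rewrite -[X in _ --> X]subr0; apply: cvgB; [exact: cvg_cst|exact: cvg_harmonicM].
- by rewrite -[X in _ --> X]addr0; apply: cvgD; [exact: cvg_cst|exact: cvg_harmonicM].
Qed.

Lemma cvg_sum_mx m n I (u : I -> nat -> 'M[R]_(m, n))
    (l : I -> 'M[R]_(m, n)) (r : seq I) :
  (forall i, u i k @[k --> \oo] --> l i) ->
  (\sum_(i <- r) u i k) @[k --> \oo] --> \sum_(i <- r) l i.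
Proof. by move=> ul; apply: cvg_big => // x; exact: add_continuous. Qed.

Lemma cvg_mulmx m n p (u : nat -> 'M[R]_(m, n)) (v : nat -> 'M[R]_(n, p))
    (lu : 'M[R]_(m, n)) (lv : 'M[R]_(n, p)) :
  u @ \oo --> lu -> v @ \oo --> lv -> (u k *m v k) @[k --> \oo] --> lu *m lv.
Proof.
move=> ulu vlv; apply: cvg_mx => i j; rewrite mxE.
under eq_cvg do rewrite mxE.
by apply: cvg_sum_fin => k; apply: cvgM; exact: cvg_mx_entry.
Qed.

End matrix_limits.
Arguments cvg_mx_entry {R m n u l} i j _.

Section matrix_exponential.
Context {R : realType} {n : nat}.
Implicit Types A B : 'M[R]_n.

Let abs_sum A : R := \sum_i \sum_j `|A i j|.

(** The sum of the absolute values of the entries is submultiplicative; its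
    powers dominate the exponential series entrywise. *)
Lemma mx_pow_entry A k i j : `|(A ^+ k) i j| <= abs_sum A ^+ k.
Proof.
have entry a b : `|A a b| <= \sum_j `|A a j|.
  by rewrite [leRHS](bigD1 b)//= lerDl sumr_ge0.
have row_le a : \sum_j `|A a j| <= abs_sum A.
  by rewrite /abs_sum [leRHS](bigD1 a)//= lerDl sumr_ge0// => *; rewrite sumr_ge0.
elim: k i => [|k IH] i.
  by rewrite !expr0 mxE; case: eqP; rewrite ?normr1 ?normr0 ?ler01.
rewrite !exprS mxE (le_trans (ler_norm_sum _ _ _))//.
apply: (@le_trans _ _ (\sum_l `|A i l| * abs_sum A ^+ k)).
  by apply: ler_sum => l _; rewrite normrM ler_wpM2l.
by rewrite -mulr_suml ler_wpM2r// exprn_ge0// (le_trans _ (row_le i))// sumr_ge0.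
Qed.

Lemma cvg_expmx A :
  series (fun k => k`!%:R^-1 *: A ^+ k) @ \oo --> expmx A.
Proof.
suff [l Al] : exists l : 'M[R]_n, series (fun k => k`!%:R^-1 *: A ^+ k) @ \oo --> l.
  by rewrite /expmx (cvg_lim (@norm_hausdorff _ _) Al).
exists (\matrix_(i, j) limn (series (fun k => k`!%:R^-1 * (A ^+ k) i j))).
apply: cvg_mx => i j; rewrite mxE.
have -> : (fun k => series (fun k => k`!%:R^-1 *: A ^+ k) k i j) =
    series (fun k => k`!%:R^-1 * (A ^+ k) i j).
  apply/funext => N; rewrite /series /= summxE.
  by apply: eq_bigr => k _; rewrite mxE.
apply: normed_cvg.
apply: (@series_le_cvg _ _ (exp_coeff (abs_sum A))) => [k|k|k|].
- exact: normr_ge0.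
- by rewrite exp_coeff_ge0// sumr_ge0// => ? _; rewrite sumr_ge0.
- rewrite /exp_coeff /= normrM mulrC [X in _ * X]ger0_norm ?invr_ge0//.
  by rewrite ler_wpM2r ?invr_ge0// mx_pow_entry.
- exact: is_cvg_series_exp_coeff.
Qed.

(** Only the term of degree 0 of the exponential series acts on the kernel. *)
Lemma expmx_fix A (v : 'cV[R]_n) : A *m v = 0 -> expmx A *m v = v.
Proof.
move=> Av; have cv := @cvg_mulmx R _ _ _ _ (fun=> v) _ _ (@cvg_expmx A) (@cvg_cst _ v _ \oo _).
apply: (@cvgn_unique R 'M[R]_(n, 1) _ _ _ (cv _)).
rewrite -cvg_shiftS; apply: cvg_near_cst; near=> N.
rewrite /series /= big_nat_recl//= fact0 invr1 scale1r expr0 mulmxDl mul1mx.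
rewrite mulmx_suml big1 ?addr0// => k _.
by rewrite exprSr -scalemxAl -mulmxA Av mulmx0 scaler0.
Unshelve. all: by end_near. Qed.

(** The remainder starts at degree 2, and t <= 1 bounds t^k by t^2 in it; this
    replaces the differentiability of t -> exp(-t B) at 0. *)
Lemma expmx_taylor B : exists2 C : R, 0 <= C & forall (t : R) i j, 0 <= t <= 1 ->
  `|expmx (- t *: B) i j - ((i == j)%:R - t * B i j)| <= t ^+ 2 * C.
Proof.
have nB0 : 0 <= abs_sum B by rewrite sumr_ge0// => ? _; rewrite sumr_ge0.
exists (expR (abs_sum B)); first exact: expR_ge0.
move=> t i j /andP[t0 t1].
have cv := @cvg_mx_entry R _ _ _ _ i j (@cvg_expmx (- t *: B)).
rewrite -(cvg_shiftn 2) /= in cv.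
have cvn : `|series (fun k => k`!%:R^-1 *: (- t *: B) ^+ k) (k + 2)%N i j -
    ((i == j)%:R - t * B i j)| @[k --> \oo] -->
    `|expmx (- t *: B) i j - ((i == j)%:R - t * B i j)|.
  by apply: cvg_norm; apply: cvgB => //; exact: cvg_cst.
rewrite -(cvg_lim _ cvn)//; apply: limr_le; first by apply/cvg_ex; eexists; exact: cvn.
near=> N.
rewrite addn2 /series /= big_nat_recl// big_nat_recl//= !fact0 !invr1 !scale1r.
rewrite expr0 expr1 addrA !mxE [X in `|X|](_ : _ =
   (\sum_(0 <= k < N) (k.+2)`!%:R^-1 *: (- t *: B) ^+ k.+2) i j); last first.
  by ring.
have powZ k : (- t *: B) ^+ k = (- t) ^+ k *: B ^+ k.
  elim: k => [|k IH]; first by rewrite !expr0 scale1r.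
  by rewrite !exprS IH -[LHS]/((_ *: _) *m (_ *: _)) -scalemxAl -scalemxAr scalerA.
rewrite summxE; apply: le_trans (ler_norm_sum _ _ _) _.
apply: (@le_trans _ _ (\sum_(0 <= k < N) t ^+ 2 * exp_coeff (abs_sum B) k.+2)).
  apply: ler_sum => k _; rewrite powZ scalerA mxE -[exp_coeff _ _]/(_ / _).
  rewrite normrM [X in X * _]normrM normrX.
  rewrite [X in X * _ * _]ger0_norm ?invr_ge0// normrN (ger0_norm t0).
  rewrite [leRHS]mulrA -mulrA [leLHS]mulrC ler_wpM2r ?invr_ge0//.
  rewrite ler_pM// ?exprn_ge0 ?mx_pow_entry//.
  by rewrite -addn2 exprD ler_piMl ?exprn_ge0// exprn_ile1.
rewrite -mulr_sumr ler_wpM2l ?exprn_ge0//.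
apply: le_trans (nondecreasing_cvgn_le _ (is_cvg_series_exp_coeff (abs_sum B)) N.+2).
  rewrite /series /= [leRHS]big_nat_recl// [X in _ + X]big_nat_recl// addrA lerDr.
  by rewrite addr_ge0// exp_coeff_ge0.
by apply: nondecreasing_series => k _ _; exact: exp_coeff_ge0.
Unshelve. all: by end_near. Qed.

End matrix_exponential.

(** * Spectral radius of a nonnegative matrix *)

Section finite_positivity.
Context {R : realFieldType}.

Lemma mulmx_ge0 m p q (A : 'M[R]_(m, p)) (B : 'M[R]_(p, q)) :
  (forall i j, 0 <= A i j) -> (forall i j, 0 <= B i j) ->
  forall i j, 0 <= (A *m B) i j.
Proof. by move=> A0 B0 i j; rewrite mxE sumr_ge0// => k _; rewrite mulr_ge0. Qed.

(** Finitely many strict inequalities at e = 0 survive for some e > 0. *)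
Lemma exists_small_scale (I : finType) (a b : I -> R) : (forall i, 0 < b i) ->
  exists2 e : R, 0 < e & forall i, e * a i < b i.
Proof.
move=> b0.
pose S := \sum_i `|a i| / b i.
have S0 : 0 <= S by rewrite sumr_ge0// => i _; rewrite divr_ge0// ltW.
exists (1 + S)^-1 => [|i]; first by rewrite invr_gt0 ltr_pwDl.
rewrite mulrC ltr_pdivrMr ?ltr_pwDl// mulrC -ltr_pdivrMr//.
rewrite (le_lt_trans (y := S)) ?ltrDr// /S (bigD1 i)//=.
rewrite -[leLHS]addr0 lerD//; first by rewrite ler_wpM2r ?invr_ge0 ?ler_norm// ltW.
by rewrite sumr_ge0// => k _; rewrite divr_ge0// ltW.
Qed.

End finite_positivity.

Section spectral.
Context {R : realType} {n : nat}.
Implicit Types L : 'M[R]_n.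

(** The complex eigenvalues are the finitely many roots of the characteristic
    polynomial, so the supremum defining the spectral radius is over a bounded
    set and dominates each of them. *)
Lemma eigenvalue_le_spectral_radius L (x : R) : 0 < x ->
  L - x%:M \notin unitmx -> x <= spectral_radius L.
Proof.
move=> x0; rewrite -row_free_unit -kermx_eq0 => ker.
have ev : eigenvalue L x by exact: ker.
rewrite /spectral_radius; apply: ub_le_sup; last first.
  exists (real_complex R x).
    by rewrite /= eigenvalue_root_char -map_char_poly fmorph_root -eigenvalue_root_char.
  by rewrite /Normc.normc /= expr0n addr0 sqrtr_sqr gtr0_norm.
set Q := map_mx _ _.
have [r rE] := closed_field_poly_normal (char_poly Q).
exists (\sum_(z <- r) Normc.normc z) => _ [z /= zQ <-].
move: zQ; rewrite eigenvalue_root_char rE rootZ ?lead_coef_eq0 ?monic_neq0 ?char_poly_monic//.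
rewrite root_prod_XsubC => zr.
rewrite (big_rem z)//= lerDl sumr_ge0// => y _.
by case: y => a b; rewrite /Normc.normc sqrtr_ge0.
Qed.

(** The set E of those t in [0, a] with a vector v > 0 such that t L v < v
    contains 0 and is closed downwards; T is its supremum.  The matrix 1 - T L is
    invertible, since otherwise 1/T would be an eigenvalue although T rho(L) < 1.
    The solution x of (1 - T L) x = 1 satisfies (1 - t L) x >= 0 for t < T close
    to T, so x >= 0 by the maximum principle at t, and then x = 1 + T L x > 0: T
    belongs to E.  As the condition is open, T = a. *)
Lemma subinvariant_vector L (a : R) : 0 <= a ->
  (forall i j, 0 <= L i j) -> a * spectral_radius L < 1 ->
  exists v : 'cV[R]_n,
    (forall i, 0 < v i 0) /\ (forall i, a * (L *m v) i 0 < v i 0).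
Proof.
move=> a0 L0 aL.
pose M (t : R) := 1%:M - t *: L.
have ME t (v : 'cV[R]_n) i : (M t *m v) i 0 = v i 0 - t * (L *m v) i 0.
  by rewrite mulmxBl mul1mx -scalemxAl !mxE.
have MZ (t : R) : 0 <= t -> Zmatrix (M t).
  by move=> t0 i j ij; rewrite !mxE (negPf ij) sub0r oppr_le0 mulr_ge0.
pose E := [set t : R | 0 <= t <= a /\ exists v : 'cV[R]_n,
  (forall i, 0 < v i 0) /\ (forall i, 0 < (M t *m v) i 0)].
have E0 : E 0.
  split; first by rewrite lexx.
  exists (const_mx 1); split=> i; rewrite ?ME ?mul0r ?subr0 !mxE//.
have ubE : has_ubound E by exists a => t [/andP[_]].
have supE : has_sup E by split; first by exists 0.
set T := sup E.
have T0 : 0 <= T by exact: ub_le_sup.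
have Ta : T <= a by apply: ge_sup; [exists 0 | move=> t [/andP[_]]].
have down (t : R) : 0 <= t -> t < T -> E t.
  move=> t0 /(sup_gt _)[|s [s01 [v [v0 Mv0]]] ts]; first by exists 0.
  split; first by rewrite t0 (le_trans (ltW ts))//; case/andP: s01.
  exists v; split=> // i; have := Mv0 i; rewrite !ME.
  have Lv : 0 <= (L *m v) i 0.
    by apply: mulmx_ge0 => // {}i j; rewrite (ord1 j) ltW.
  by move=> /lt_le_trans; apply; rewrite lerB// ler_wpM2r// ltW.
have ET : E T.
  have [->//|T_gt0] := eqVneq T 0.
  have Tgt0 : 0 < T by rewrite lt_neqAle eq_sym T_gt0.
  have MTu : M T \in unitmx.
    apply: contraLR aL => MTn; rewrite -leNgt.
    have : T^-1 <= spectral_radius L.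
      apply: eigenvalue_le_spectral_radius; first by rewrite invr_gt0.
      apply: contra MTn => u.
      have -> : M T = - T *: (L - T^-1%:M).
        rewrite scalerBr scale_scalar_mx mulNr divff// /M scaleNr.
        by rewrite -[(-1)%:M]scalemx1 scaleN1r opprK addrC.
      by rewrite unitmxZ// unitfE oppr_eq0.
    move=> Trho; rewrite (@le_trans _ _ (T * spectral_radius L))//.
      by rewrite -(ler_pM2l Tgt0) divff in Trho.
    by rewrite ler_wpM2r// (le_trans _ Trho)// invr_ge0.
  pose x := invmx (M T) *m const_mx 1 : 'cV[R]_n.
  have Mx i : (M T *m x) i 0 = 1 by rewrite mulKVmx// mxE.
  have x0 i : 0 <= x i 0.
    have [e e0 eL] := @exists_small_scale R _ (fun i => - (L *m x) i 0) (fun=> 1) (fun=> ltr01).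
    pose t := Num.max (T - e) 0.
    have [_ [v [v0 Mv0]]] : E t.
      apply: down; first by rewrite le_max lexx orbT.
      by rewrite gt_max Tgt0 andbT; lra.
    apply: (Zmatrix_mono (MZ t _) (dominated_pos v0 Mv0)).
      by rewrite le_max lexx orbT.
    move=> j; have := Mx j; have := eL j; rewrite !ME.
    have : T - e <= t <= T by rewrite le_max lexx/= ge_max T0 andbT; lra.
    move=> /andP[]; move: ((L *m x) j 0) (x j 0) => y z *; nra.
  split; first by rewrite T0 Ta.
  exists x; split=> i; rewrite ?Mx//.
  have := Mx i; rewrite ME => /eqP; rewrite subr_eq => /eqP ->.
  rewrite ltr_wpDr// mulr_ge0// mulmx_ge0// => ? j; by rewrite (ord1 j).
have [_ [v [v0 Mv0]]] := ET.
have [->|Tna] := eqVneq a T.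
  by exists v; split=> // i; rewrite -subr_gt0 -ME.
have [e e0 eL] := @exists_small_scale R _ (fun i => (L *m v) i 0) (fun i => (M T *m v) i 0) Mv0.
pose t := Num.min (T + e) a.
have Et : E t.
  split.
    by rewrite le_min a0 ge_min lexx orbT !andbT; lra.
  exists v; split=> // i; rewrite ME; have := eL i; rewrite ME.
  have Lv : 0 <= (L *m v) i 0.
    by apply: mulmx_ge0 => // {}i j; rewrite (ord1 j) ltW.
  have : t <= T + e by rewrite ge_min lexx.
  move: Lv; move: ((L *m v) i 0) (v i 0) => y z *; nra.
have : t <= T by exact: ub_le_sup.
rewrite ge_min => /orP[|aT]; first by lra.
by rewrite eq_le aT Ta in Tna.
Qed.

End spectral.

(** * Integrals of products under a product rule *)

Section product_rule.
Context d (T : measurableType d) (R : realType).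
Local Open Scope ereal_scope.

Lemma ge0_integral_mrestr (mu : {measure set T -> \bar R}) (D : set T)
    (mD : measurable D) (f : T -> \bar R) :
  measurable_fun setT f -> (forall x, 0 <= f x) ->
  \int[mrestr mu mD]_x f x = \int[mu]_(x in D) f x.
Proof.
move=> mf f0; rewrite (@ge0_negligible_integral _ _ _ _ setT (~` D))//.
- rewrite setTD setCK; apply: eq_measure_integral => A mA AD.
  by rewrite /= /mrestr setIidl.
- exact: measurableC.
- by rewrite /= /mrestr setICl measure0.
Qed.

Variables (d' : measure_display) (T' : measurableType d')
  (mu : {finite_measure set T -> \bar R}) (mu' : {finite_measure set T' -> \bar R}).

(** The law of (X, Y) on D is the product of the law of X on D and the law of Z,
    by uniqueness of the product measure; Tonelli factors the integral. *)
Lemma integral_mul_indep (D : set T) (X Y : T -> R) (Z : T' -> R) :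
  measurable D -> measurable_fun setT X -> measurable_fun setT Y ->
  measurable_fun setT Z ->
  (forall w, (0 <= X w)%R) -> (forall w, (0 <= Y w)%R) ->
  (forall w, (0 <= Z w)%R) ->
  (forall A B : set R, measurable A -> measurable B ->
     mu (D `&` X @^-1` A `&` Y @^-1` B) = mu (D `&` X @^-1` A) * mu' (Z @^-1` B)) ->
  \int[mu]_(w in D) (X w * Y w)%:E =
  \int[mu]_(w in D) (X w)%:E * \int[mu']_w (Z w)%:E.
Proof.
move=> mD mX mY mZ X0 Y0 Z0 XY.
have mXY : measurable_fun setT (fun w => (X w, Y w)) by exact/measurable_fun_pair.
pose image_X : {measure set R -> \bar R} := pushforward (mrestr mu mD) X.
pose m1 := image_X mX.
have m1oo : m1 setT < +oo.
  rewrite /m1 /image_X /= /pushforward preimage_setT /mrestr setTI.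
  by rewrite -ge0_fin_numE// fin_num_measure.
pose m1f : {finite_measure set R -> \bar R} := mfrestr measurableT m1oo.
pose image_Z : {measure set R -> \bar R} := pushforward mu' Z.
have m2oo : image_Z mZ setT < +oo.
  rewrite /image_Z /= /pushforward preimage_setT.
  by rewrite -ge0_fin_numE// fin_num_measure.
pose nu : {finite_measure set R -> \bar R} := mfrestr measurableT m2oo.
pose image_XY : {measure set (R * R) -> \bar R} :=
  pushforward (mrestr mu mD) (fun w => (X w, Y w)).
pose m' := image_XY mXY.
(* Truncation at 0 makes the integrand nonnegative on the whole plane without
   changing it on the range of (X, Y). *)
pose f (z : (R * R)%type) := (Num.max z.1 0 * Num.max z.2 0)%:E.
have mmax : measurable_fun setT (fun x : R => Num.max x 0%R).
  exact: measurable_maxr.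
have mf : measurable_fun setT f.
  apply/measurable_EFinP; apply: measurable_funM.
    by apply: (measurableT_comp mmax).
  by apply: (measurableT_comp mmax).
have f0 z : 0 <= f z by rewrite lee_fin mulr_ge0// le_max lexx orbT.
transitivity (\int[m']_z f z).
  rewrite ge0_integral_pushforward//= ge0_integral_mrestr//.
    by apply: eq_integral => w _; rewrite /f /= !max_l.
  exact: measurableT_comp.
transitivity (\int[m1f \x nu]_z f z).
  apply: eq_measure_integral => A mA _; apply/esym.
  apply: product_measure_unique => //= B C mB mC.
  rewrite /m' /= /m1 /mfrestr /mrestr !setIT /= /pushforward setIC [X in _ = mu X * _]setIC -XY//.
  congr (mu _); apply/seteqP; split=> w /=; tauto.
rewrite fubini_tonelli1//=.
rewrite /fubini_F /f /=.
under eq_integral => x _.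
  under eq_integral do rewrite EFinM.
  rewrite ge0_integralZl//; last 3 first.
  - exact/measurable_EFinP.
  - by move=> y _; rewrite lee_fin le_max lexx orbT.
  - by rewrite lee_fin le_max lexx orbT.
  over.
rewrite ge0_integralZr//; last 3 first.
- exact/measurable_EFinP.
- by move=> y _; rewrite lee_fin le_max lexx orbT.
- by apply: integral_ge0 => y _; rewrite lee_fin le_max lexx orbT.
have int_max d0 (T0 : measurableType d0) (m0 : {measure set T0 -> \bar R})
    (D0 : set T0) (U : T0 -> R) : measurable D0 -> measurable_fun setT U ->
    (forall w, (0 <= U w)%R) ->
    \int[m0]_(x in D0) (Num.max (U x) 0%R)%:E = \int[m0]_(x in D0) (U x)%:E.
  by move=> mD0 mU U0; apply: eq_integral => x _; rewrite max_l.
have max0 (y : R) : 0 <= (Num.max y 0%R)%:E by rewrite lee_fin le_max lexx orbT.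
have mmaxE : measurable_fun setT (fun y : R => (Num.max y 0%R)%:E).
  exact/measurable_EFinP.
congr (_ * _).
  rewrite (_ : \int[m1f]_x _ = \int[m1]_x (Num.max x 0%R)%:E); last first.
    by apply: eq_measure_integral => A mA _; rewrite /= /mfrestr /mrestr setIT.
  rewrite ge0_integral_pushforward//= ge0_integral_mrestr ?int_max//.
  exact: (measurableT_comp mmaxE).
rewrite (_ : \int[nu]_x _ = \int[image_Z mZ]_x (Num.max x 0%R)%:E); last first.
  by apply: eq_measure_integral => A mA _; rewrite /= /mfrestr /mrestr setIT.
by rewrite ge0_integral_pushforward//= -[RHS]int_max.
Qed.

End product_rule.

(** * Riemann sums of the exponential functional and the Markov property *)

Section discount.
Context {R : realType}.
Implicit Types x y : \bar R.

(** Real-valued e^(-x), with e^(-oo) = 0.  The junk value 0 at -oo is never met: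
    positions are finite or +oo. *)
Definition discount x : R := fine (expeR (- x)).

Lemma discount_ge0 x : 0 <= discount x.
Proof. by rewrite /discount fine_ge0 ?expeR_ge0. Qed.

Lemma discount_fin (r : R) : discount r%:E = expR (- r).
Proof. by []. Qed.

Lemma discount_oo : discount +oo%E = 0.
Proof. by []. Qed.

Lemma discount_expeR x : x != -oo%E -> expeR (- x) = (discount x)%:E.
Proof. by case: x. Qed.

Lemma discount_le x y : x != -oo%E -> (x <= y)%E -> discount y <= discount x.
Proof.
move: x y => [x| |] [y| |]//= _; rewrite ?lee_fin ?discount_oo ?discount_ge0//.
by move=> xy; rewrite !discount_fin ler_expR lerN2.
Qed.

(** Exponential form of xi_(h+s) = xi_h + (xi_(h+s) - xi_h), valid also when the
    process is killed between h and h + s. *)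
Lemma discount_mul (r : R) x : x != -oo%E ->
  discount r%:E * discount (x - r%:E) = discount x.
Proof.
case: x => [s| |]//= _; last by rewrite discount_oo mulr0.
by rewrite -EFinB !discount_fin -expRD; congr expR; ring.
Qed.

Lemma measurable_discount : measurable_fun setT discount.
Proof.
pose F := [set x : \bar R | x \is a fin_num].
have mF : measurable F.
  have := @emeasurable_fin_num _ _ R setT idfun measurableT (@measurable_id _ _ _).
  by rewrite setTI.
rewrite (_ : discount = fun x => expR (- fine x) * \1_F x).
  apply: measurable_funM.
    by apply: measurableT_comp => //; apply: measurableT_comp.
  exact: measurable_indic.
apply/funext => -[r| |]; rewrite indicE.
- by rewrite mem_set//= mulr1.
- by rewrite memNset//= mulr0.
- by rewrite memNset//= mulr0.
Qed.

End discount.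

Section process.
Context {R : realType} {K : nat} {d : measure_display} {Omega : measurableType d}.
Variables (P : R -> 'I_K -> probability Omega R)
  (xi : R -> Omega -> \bar R) (J : R -> Omega -> phase K).

(** A functional of the whole trajectory, so that it applies both to the process
    and to its increments after a given time. *)
Definition riemann (h : R) (m : nat) (f : R -> (\bar R * phase K)%type) : R :=
  h * \sum_(n < m) discount (f (n%:R * h)).1.

Lemma riemann_ge0 h m f : 0 <= h -> 0 <= riemann h m f.
Proof. by move=> h0; rewrite mulr_ge0// sumr_ge0// => n _; exact: discount_ge0. Qed.

(** The functional reads finitely many coordinates. *)
Lemma riemann_path_event h m (B : set R) : 0 <= h -> measurable B ->
  path_events (riemann h m @^-1` B).
Proof.
move=> h0 mB.
pose G : set (set (R -> (\bar R * phase K)%type)) :=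
  \bigcup_(t in `[0, +oo[) preimage_set_system setT (fun f => f t) measurable.
have coord (t : R) : 0 <= t ->
    measurable_fun (setT : set (g_sigma_algebraType G)) (fun f : g_sigma_algebraType G => f t).
  move=> t0 _ C mC; rewrite setTI; apply: sub_sigma_algebra.
  exists t; first by rewrite /= in_itv /= t0.
  by exists C; rewrite ?setTI.
have : measurable_fun (setT : set (g_sigma_algebraType G)) (riemann h m).
  apply: measurable_funM => //; apply: measurable_sum => n.
  apply: measurableT_comp; first exact: measurable_discount.
  by apply: measurableT_comp; [exact: measurable_fst|apply: coord; rewrite mulr_ge0].
by move=> /(_ measurableT _ mB); rewrite setTI.
Qed.

Definition trajectory (w : Omega) (s : R) := joint xi J s w.

Hypothesis hMAP : is_MAP P xi J.
Hypothesis hmono : nondecreasing_position xi.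

Lemma position_fin t w j : 0 <= t -> J t w = Some j -> xi t w \is a fin_num.
Proof. by move=> t0 Jt; apply: (map_finite hMAP) => //; rewrite Jt. Qed.

Lemma position_neqNy t w : 0 <= t -> xi t w != -oo%E.
Proof.
move=> t0; case Jt : (J t w) => [j|].
  by move: (position_fin t0 Jt); case: (xi t w).
by rewrite (map_cemetery hMAP t0 Jt).
Qed.

Lemma measurable_position t : 0 <= t -> measurable_fun setT (xi t).
Proof.
move=> t0; have := map_measurable hMAP t0.
by move=> /(measurableT_comp measurable_fst).
Qed.

Definition alive t j := [set w | J t w = Some j].

Lemma measurable_alive t j : 0 <= t -> measurable (alive t j).
Proof.
move=> t0; have := measurableT_comp measurable_snd (map_measurable hMAP t0).
by move=> /(_ measurableT [set Some j] Logic.I); rewrite setTI.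
Qed.

Lemma measurable_discount_position t : 0 <= t ->
  measurable_fun setT (fun w => discount (xi t w)).
Proof.
by move=> t0; apply: (measurableT_comp measurable_discount); exact: measurable_position.
Qed.

Lemma measurable_riemann_trajectory h m : 0 <= h ->
  measurable_fun setT (fun w => riemann h m (trajectory w)).
Proof.
move=> h0; apply: measurable_funM => //; apply: measurable_sum => n.
by apply: measurable_discount_position; rewrite mulr_ge0.
Qed.

Lemma measurable_riemann_increments h m t : 0 <= h -> 0 <= t ->
  measurable_fun setT (fun w => riemann h m (increments xi J t w)).
Proof.
move=> h0 t0; apply: measurable_funM => //; apply: measurable_sum => n.
apply: (measurableT_comp measurable_discount).
by apply: emeasurable_funB; apply: measurable_position; rewrite ?addr_ge0// mulr_ge0.
Qed.

Lemma start_at_zero i : {ae P 0 i, forall w, xi 0 w = 0%E}.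
Proof.
have mE : measurable [set w | joint xi J 0 w = (0%:E, Some i)].
  have := map_measurable hMAP (lexx 0) measurableT (Y := [set (0%:E, Some i)]).
  rewrite setTI; apply.
  rewrite (_ : [set _] = [set 0%:E] `*` [set Some i]).
    exact: measurableX.
  by apply/seteqP; split => -[a b] /=; [case=> -> ->|case=> -> ->].
exists (~` [set w | joint xi J 0 w = (0%:E, Some i)]); split.
- exact: measurableC.
- by rewrite probability_setC// (map_start hMAP) subee.
- by move=> w /= /[swap] -[].
Qed.

(** The first term of the sum is h.  If the process is dead at time h, all other
    terms vanish, and so does the discount factor on the right. *)
Lemma riemannS h m w : 0 < h -> xi 0 w = 0%E ->
  riemann h m.+1 (trajectory w) =
  h + discount (xi h w) * riemann h m (increments xi J h w).
Proof.
move=> h0 xi0; rewrite /riemann big_ord_recl/= mul0r xi0.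
rewrite mulrDr -[0%E]/(0%:E) discount_fin oppr0 expR0 mulr1; congr (_ + _).
rewrite mulrCA; congr (_ * _); rewrite mulr_sumr; apply: eq_bigr => n _.
have hn : (bump 0 n)%:R * h = h + n%:R * h.
  by rewrite /bump /= natrD mulrDl mul1r.
rewrite hn; have hn0 : 0 <= h + n%:R * h by rewrite addr_ge0 ?mulr_ge0 ?(ltW h0).
case Jh : (J h w) => [j|].
  by have /fineK <- := position_fin (ltW h0) Jh; rewrite discount_mul// position_neqNy.
rewrite (map_cemetery hMAP (ltW h0) Jh) discount_oo mul0r.
rewrite (map_cemetery hMAP hn0) ?discount_oo//.
by apply: (map_absorbing hMAP (ltW h0) _ Jh); rewrite lerDl mulr_ge0 ?(ltW h0).
Qed.

Lemma discount_dead t w l : 0 <= t -> (0 < l)%N -> J t w = None ->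
  discount (xi t w) ^+ l = 0.
Proof.
by move=> t0 l0 Jt; rewrite (map_cemetery hMAP t0 Jt) discount_oo expr0n gtn_eqF.
Qed.

Local Open Scope ereal_scope.

Definition moment h m k i := \int[P 0%R i]_w ((riemann h m (trajectory w)) ^+ k)%:E.

(** The discount at time h is an event-wise function of the past of h and the
    Riemann sum of the increments is a functional of the future, so the Markov
    additive property is exactly the product rule needed for the integrals to
    factor. *)
Lemma markov_moment h m l i j : (0 < h)%R ->
  \int[P 0%R i]_(w in alive h j)
    (discount (xi h w) ^+ l * riemann h m (increments xi J h w) ^+ l)%:E =
  \int[P 0%R i]_(w in alive h j) (discount (xi h w) ^+ l)%:E * moment h m l j.
Proof.
move=> h0; have h0' := ltW h0.
apply: (integral_mul_indep (X := fun w => (discount (xi h w) ^+ l)%R)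
  (Y := fun w => (riemann h m (increments xi J h w) ^+ l)%R)
  (Z := fun w => (riemann h m (trajectory w) ^+ l)%R)).
- exact: measurable_alive.
- by apply: measurable_funX; exact: measurable_discount_position.
- by apply: measurable_funX; exact: measurable_riemann_increments.
- by apply: measurable_funX; exact: measurable_riemann_trajectory.
- by move=> w; rewrite exprn_ge0// discount_ge0.
- by move=> w; rewrite exprn_ge0// riemann_ge0.
- by move=> w; rewrite exprn_ge0// riemann_ge0.
move=> A B mA mB.
have mX := measurable_funX l (@measurable_id _ R setT).
have mAl : measurable [set y : R | A (y ^+ l)%R] by rewrite -[X in measurable X]setTI; exact: mX.
have mBl : measurable [set y : R | B (y ^+ l)%R] by rewrite -[X in measurable X]setTI; exact: mX.
have past : sigma_of (joint xi J) `[0%R, h]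
    ((fun w => (discount (xi h w) ^+ l)%R) @^-1` A).
  apply: sub_sigma_algebra; exists h; first by rewrite /= in_itv /= h0' lexx.
  exists [set z : \bar R * phase K | A (discount z.1 ^+ l)%R]; last by rewrite setTI.
  have := measurableT_comp (@measurable_discount R) (@measurable_fst _ _ (\bar R) (phase K)).
  by move=> /(_ measurableT _ mAl); rewrite setTI.
have := map_markov_additive hMAP 0%R i j h0' past (riemann_path_event m h0' mBl).
rewrite /alive /= => E.
rewrite [X in P _ _ X = _ * _](_ : _ =
  ((fun w => (discount (xi h w) ^+ l)%R) @^-1` A) `&` [set w | J h w = Some j] `&`
  [set w | (riemann h m @^-1` [set y | B (y ^+ l)%R]) (increments xi J h w)]).
  by rewrite E; congr (P _ _ _ * P _ _ _); rewrite setIC.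
by apply/seteqP; split=> w /=; tauto.
Qed.

End process.

(** * The Bernstein matrix as a generator; recursion for the moments *)

(** How inequalities for a semigroup near time 0 pass to its generator. *)
Lemma small_time_ge0 (R : realFieldType) (x C : R) : 0 <= C ->
  (forall t, 0 <= t <= 1 -> 0 <= t * x + t ^+ 2 * C) -> 0 <= x.
Proof.
move=> C0 H; rewrite leNgt; apply/negP => x0.
pose y := - x; have y0 : 0 < y by rewrite /y oppr_gt0.
pose D := y + C + 1; have D0 : 0 < D by rewrite /D; lra.
have tD : y / D * D = y by rewrite divfK ?gt_eqF.
have t0 : 0 < y / D by rewrite divr_gt0.
have t1 : y / D <= 1 by rewrite ler_pdivrMr// mul1r /D; lra.
have := H (y / D); rewrite (ltW t0) t1 => /(_ isT).
have -> : x = - y by rewrite /y opprK.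
move: tD t0 {H t1}; move: (y / D) => t tD t0.
rewrite /D in tD; nra.
Qed.

(** Everything that is used of the matrices Phi(l) and G(l, t) = exp(-t Phi(l)):
    the entries of G(l, t) are discounted transition probabilities, Phi(l) is the
    generator to second order, and vectors killed by Phi(l) are fixed by G(l, t).
    Reasoning from these properties alone keeps the explicit formula for Phi,
    with its integrals, out of the proofs. *)
Record discounted_semigroup (R : realType) (K : nat) (d : measure_display)
    (Omega : measurableType d) (P : R -> 'I_K -> probability Omega R)
    (xi : R -> Omega -> \bar R) (J : R -> Omega -> phase K)
    (Phi : nat -> 'M[R]_K) (G : nat -> R -> 'M[R]_K) : Prop := {
  semigroup_entry : forall l t i j, 0 <= t ->
    (\int[P 0%R i]_(w in alive J t j) (discount (xi t w) ^+ l)%:E = (G l t i j)%:E)%E;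
  semigroup_taylor : forall l, exists2 C : R, 0 <= C &
    forall (t : R) i j, 0 <= t <= 1 ->
    `|G l t i j - ((i == j)%:R - t * Phi l i j)| <= t ^+ 2 * C;
  semigroup_fix : forall l t (v : 'cV_K), Phi l *m v = 0 -> G l t *m v = v }.

Section semigroup.
Context {R : realType} {K : nat} {d : measure_display} {Omega : measurableType d}.
Variables (P : R -> 'I_K -> probability Omega R)
  (xi : R -> Omega -> \bar R) (J : R -> Omega -> phase K)
  (Phi : nat -> 'M[R]_K) (G : nat -> R -> 'M[R]_K).
Hypothesis hMAP : is_MAP P xi J.
Hypothesis hmono : nondecreasing_position xi.
Hypothesis hG : discounted_semigroup P xi J Phi G.


Lemma integral_prob_cst i (r : R) : (\int[P 0%R i]_w r%:E = r%:E)%E.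
Proof. by rewrite integral_cst//= probability_setT mule1. Qed.

Lemma semigroup_ge0 l t i j : 0 <= t -> 0 <= G l t i j.
Proof.
move=> t0; rewrite -lee_fin -(semigroup_entry hG)//; apply: integral_ge0 => w _.
by rewrite lee_fin exprn_ge0// discount_ge0.
Qed.

Lemma discount_le1 t w : 0 <= t -> xi 0 w = 0%E -> discount (xi t w) <= 1.
Proof.
move=> t0 xi0; rewrite -[1]expR0 -oppr0 -discount_fin.
by apply: discount_le => //; rewrite -[0%:E]xi0; exact: hmono.
Qed.

Lemma ae_start i (Q : Omega -> Prop) : (forall w, xi 0 w = 0%E -> Q w) ->
  {ae P 0 i, forall w, Q w}.
Proof. by move=> H; apply: filterS (start_at_zero hMAP i) => w; exact: H. Qed.

Lemma measurable_discountX t l (D : set Omega) : 0 <= t ->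
  measurable_fun D (fun w => (discount (xi t w) ^+ l)%:E).
Proof.
move=> t0; apply: (@measurable_funS _ _ _ _ setT) => //.
apply/measurable_EFinP; apply: measurable_funX.
exact: (measurable_discount_position hMAP).
Qed.

Lemma semigroup_nonincreasing l l' t i j : 0 <= t -> (l <= l')%N ->
  G l' t i j <= G l t i j.
Proof.
move=> t0 ll'; rewrite -lee_fin -(semigroup_entry hG l' i j t0) -(semigroup_entry hG l i j t0).
apply: ae_ge0_le_integral.
- exact: (measurable_alive hMAP).
- by move=> w _; rewrite lee_fin exprn_ge0// discount_ge0.
- exact: measurable_discountX.
- by move=> w _; rewrite lee_fin exprn_ge0// discount_ge0.
- exact: measurable_discountX.
apply: ae_start => w xi0 _; rewrite lee_fin.
by apply: ler_wiXn2l => //; [exact: discount_ge0|exact: discount_le1].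
Qed.

(** A function vanishing on dead paths is integrated phase by phase. *)
Lemma integral_alive t i (f : Omega -> \bar R) : 0 <= t ->
  measurable_fun setT f -> (forall w, 0 <= f w)%E ->
  (forall w, J t w = None -> f w = 0%E) ->
  (\int[P 0%R i]_w f w = \sum_j \int[P 0%R i]_(w in alive J t j) f w)%E.
Proof.
move=> t0 mf f0 fN.
under [RHS]eq_bigr do rewrite integral_mkcond.
rewrite -ge0_integral_sum//; last 2 first.
- move=> j; apply/measurable_restrict => //; first exact: (measurable_alive hMAP).
  by rewrite setTI; exact: measurable_funS mf.
- by move=> j w _; apply: erestrict_ge0.
apply: eq_integral => w _; rewrite /=.
case Jw : (J t w) => [j|]; last first.
  rewrite big1 ?fN// => k _; rewrite patchE memNset//= /alive /=.
  by rewrite Jw.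
rewrite (bigD1 j)//= big1 ?adde0.
  by rewrite patchE mem_set.
move=> k kj; rewrite patchE memNset//= /alive /= Jw => -[jk].
by rewrite jk eqxx in kj.
Qed.

(** The exponent l > 0 matters: e^(-l xi_t) then vanishes after death, so the sum
    over the phases loses nothing. *)
Lemma semigroup_row l t i : 0 <= t -> (0 < l)%N ->
  ((\sum_j G l t i j)%:E = \int[P 0%R i]_w (discount (xi t w) ^+ l)%:E)%E.
Proof.
move=> t0 l0; rewrite (integral_alive _ t0).
- by rewrite -sumEFin; apply: eq_bigr => j _; rewrite (semigroup_entry hG).
- exact: measurable_discountX.
- by move=> w; rewrite lee_fin exprn_ge0// discount_ge0.
- by move=> w Jw; rewrite (discount_dead hMAP).
Qed.

Lemma semigroup_row_le1 l t i : 0 <= t -> (0 < l)%N -> \sum_j G l t i j <= 1.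
Proof.
move=> t0 l0; rewrite -lee_fin semigroup_row//.
apply: (@le_trans _ _ (\int[P 0%R i]_w (cst 1%:E w))%E).
  apply: ae_ge0_le_integral => //.
  - by move=> w _; rewrite lee_fin exprn_ge0// discount_ge0.
  - exact: measurable_discountX.
  apply: ae_start => w xi0 _; rewrite lee_fin exprn_ile1//.
    exact: discount_ge0.
  exact: discount_le1.
by rewrite integral_cst// mul1e probability_le1.
Qed.

(** Off the diagonal, G(l, t) is nonnegative and equals - t Phi(l) + O(t^2). *)
Lemma bernstein_Zmatrix l : Zmatrix (Phi l).
Proof.
move=> i j ij; rewrite -oppr_ge0; have [C C0 HC] := semigroup_taylor hG l.
apply: (small_time_ge0 C0) => t /andP[t0 t1].
have := HC t i j; rewrite t0 t1 (negPf ij) sub0r => /(_ isT).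
rewrite ler_norml => /andP[_]; have := semigroup_ge0 l i j t0.
lra.
Qed.

(** The row sums of G(l, t) are at most 1, and equal 1 - t Phi(l) 1 + O(t^2). *)
Lemma bernstein_row_ge0 l i : (0 < l)%N -> 0 <= (Phi l *m (const_mx 1 : 'cV_K)) i 0.
Proof.
move=> l0; have [C C0 HC] := semigroup_taylor hG l.
have KC0 : 0 <= K%:R * C by rewrite mulr_ge0.
apply: (small_time_ge0 KC0) => t /andP[t0 t1].
have : \sum_j ((i == j)%:R - t * Phi l i j - t ^+ 2 * C) <= \sum_j G l t i j.
  apply: ler_sum => j _; have := HC t i j; rewrite t0 t1 => /(_ isT).
  by rewrite ler_norml => /andP[+ _]; lra.
move=> /le_trans/(_ (semigroup_row_le1 i t0 l0)).
rewrite !sumrB (bigD1 i)//= eqxx big1 => [|j]; last by rewrite eq_sym => /negPf ->.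
rewrite sumr_const card_ord -mulr_sumr mxE.
rewrite [X in _ -> 0 <= t * X + _](eq_bigr (Phi l i)); last first.
  by move=> j _; rewrite mxE mulr1.
rewrite -mulr_natl -[true%:R]/(1 : R); move: (\sum_j Phi l i j) => x; lra.
Qed.

(** G(l, t) is entrywise nonincreasing in l because positions are nonnegative;
    at t = 0 it does not depend on l. *)
Lemma bernstein_mono l l' i j : (l <= l')%N -> Phi l i j <= Phi l' i j.
Proof.
move=> ll'; rewrite -subr_ge0; have [C C0 HC] := semigroup_taylor hG l.
have [C' C'0 HC'] := semigroup_taylor hG l'.
apply: (small_time_ge0 (addr_ge0 C0 C'0)) => t /andP[t0 t1].
have := HC t i j; rewrite t0 t1 => /(_ isT); rewrite ler_norml => /andP[_ +].
have := HC' t i j; rewrite t0 t1 => /(_ isT); rewrite ler_norml => /andP[+ _].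
have := semigroup_nonincreasing i j t0 ll'.
move: (G l t i j) (G l' t i j) (Phi l i j) (Phi l' i j) => a b x y; lra.
Qed.

(** If Phi(l) 1 = 0 then E_i[e^(-l xi_t)] = 1 for every t, although
    e^(-l xi_t) <= 1; hence xi_t = 0 almost surely.  Integer times suffice, by
    monotonicity of the paths. *)
Lemma conservative_constant l : (0 < l)%N ->
  Phi l *m (const_mx 1 : 'cV_K) = 0 -> as_constant_position P xi.
Proof.
move=> l0 Phi1 i.
have one (n : nat) : {ae P 0 i, forall w, xi n%:R w = 0%E}.
  have n0 : 0 <= n%:R :> R by [].
  have G1 : \sum_j G l n%:R i j = 1.
    have := congr1 (fun v : 'cV_K => v i 0) (semigroup_fix hG n%:R Phi1).
    rewrite !mxE => E; rewrite -[RHS]E.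
    by apply: eq_bigr => j _; rewrite mxE mulr1.
  have mX : measurable_fun setT (fun w => discount (xi n%:R w) ^+ l).
    by apply: measurable_funX; exact: (measurable_discount_position hMAP).
  have : (\int[P 0%R i]_w `|(1 - discount (xi n%:R w) ^+ l)%:E| = 0)%E.
    have -> : (\int[P 0%R i]_w `|(1 - discount (xi n%:R w) ^+ l)%:E| =
       \int[P 0%R i]_w ((1%R)%:E - (discount (xi n%:R w) ^+ l)%:E))%E.
      apply: ae_eq_integral => //.
      - by apply: measurableT_comp => //; apply/measurable_EFinP; exact: measurable_funB.
      - by apply: emeasurable_funB => //; exact/measurable_EFinP.
      apply: ae_start => w xi0 _; rewrite -EFinB gee0_abs// lee_fin subr_ge0.
      by rewrite exprn_ile1 ?discount_ge0 ?discount_le1.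
    rewrite integralB//=.
    - by rewrite integral_prob_cst -semigroup_row// G1 subee.
    - exact: finite_measure_integrable_cst.
    - apply/integrableP; split; first exact/measurable_EFinP.
      under eq_integral => w _ do rewrite gee0_abs ?lee_fin ?exprn_ge0 ?discount_ge0//.
      by rewrite -semigroup_row// ltry.
  move=> /ae_eq_integral_abs => /(_ measurableT).
  have mB : measurable_fun setT (fun w => (1 - discount (xi n%:R w) ^+ l)%:E).
    by apply/measurable_EFinP; exact: measurable_funB.
  move=> /(_ mB) => H.
  apply: filterS2 H (start_at_zero hMAP i) => w /(_ I) /= [] /eqP.
  rewrite subr_eq0 eq_sym => /eqP q1 xi0.
  have xin : (0 <= xi n%:R w)%E by rewrite -xi0; exact: hmono.
  move: q1 xin; case: (xi n%:R w) => [r| |]//=.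
    rewrite lee_fin discount_fin => q1 r0; congr (_%:E).
    apply/eqP; move/eqP: q1; rewrite (pexpr_eq1 l0 (expR_ge0 _)).
    by rewrite -expR0 => /eqP/expR_inj/eqP; rewrite oppr_eq0.
  by rewrite discount_oo expr0n gtn_eqF//= => /eqP; rewrite eq_sym oner_eq0.
apply: filterS2 (ae_foralln one) (start_at_zero hMAP i) => w xin xi0 t t0.
rewrite xi0; apply/eqP; rewrite eq_le; apply/andP; split.
  rewrite -(xin (Num.trunc t).+1); apply: hmono => //.
  by rewrite ltW// truncnS_gt.
by rewrite -xi0; exact: hmono.
Qed.

(** Binomial expansion of the k-th power of h + e^(-xi_h) S'.  The term l = 0 is
    the constant h^k, also on dead paths; in the other terms the Markov property
    factors the expectation. *)
Lemma moment_rec h m k i : 0 < h ->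
  (moment P xi J h m.+1 k i = (h ^+ k)%:E + \sum_(l < k)
     ('C(k, l.+1)%:R * h ^+ (k - l.+1))%:E *
     \sum_j (G l.+1 h i j)%:E * moment P xi J h m l.+1 j)%E.
Proof.
move=> h0; have h0' := ltW h0.
pose S w := riemann h m (increments xi J h w).
have S0 w : 0 <= S w by exact: riemann_ge0.
have mS : measurable_fun setT S by exact: (measurable_riemann_increments hMAP).
have mq : measurable_fun setT (fun w => discount (xi h w)).
  exact: (measurable_discount_position hMAP).
pose F (l : nat) w := 'C(k, l)%:R * h ^+ (k - l) * (discount (xi h w) ^+ l * S w ^+ l).
have F0 l w : 0 <= F l w.
  by rewrite !mulr_ge0// ?exprn_ge0// discount_ge0.
have mF l : measurable_fun setT (fun w => (F l w)%:E).
  apply/measurable_EFinP; apply: measurable_funM => //.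
  by apply: measurable_funM; exact: measurable_funX.
transitivity (\int[P 0%R i]_w (\sum_(l < k.+1) (F l w)%:E))%E.
  apply: ge0_ae_eq_integral => //.
  - apply/measurable_EFinP; apply: measurable_funX.
    exact: (measurable_riemann_trajectory hMAP).
  - by apply: emeasurable_sum => l; exact: mF.
  - by move=> w _; rewrite lee_fin exprn_ge0// riemann_ge0.
  - by move=> w _; apply: sume_ge0 => l _; rewrite lee_fin.
  apply: ae_start => w xi0 _; rewrite (riemannS hMAP)// exprDn sumEFin.
  by congr (_%:E); apply: eq_bigr => l _; rewrite /F exprMn -mulr_natl mulrA.
rewrite ge0_integral_sum//; last by move=> l w _; rewrite lee_fin.
rewrite big_ord_recl /=; congr (_ + _)%E.
  under eq_integral do rewrite /F bin0 subn0 !expr0 !mul1r mulr1.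
  exact: integral_prob_cst.
apply: eq_bigr => l _; rewrite /bump leq0n add1n /F.
under eq_integral do rewrite EFinM.
rewrite ge0_integralZl//; last 3 first.
- by apply/measurable_EFinP; apply: measurable_funM; exact: measurable_funX.
- by move=> w _; rewrite lee_fin mulr_ge0// exprn_ge0// discount_ge0.
- by rewrite lee_fin mulr_ge0// exprn_ge0.
congr (_ * _)%E; rewrite (integral_alive _ h0').
- apply: eq_bigr => j _; rewrite (markov_moment hMAP)// (semigroup_entry hG)//.
- by apply/measurable_EFinP; apply: measurable_funM; exact: measurable_funX.
- by move=> w; rewrite lee_fin mulr_ge0// exprn_ge0// discount_ge0.
- by move=> w Jw; rewrite (discount_dead hMAP)// mul0r.
Qed.

End semigroup.

(** * The exponential functional lies between its Riemann sums *)

Section exponential_functional.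
Context {R : realType} {K : nat} {d : measure_display} {Omega : measurableType d}.
Variables (P : R -> 'I_K -> probability Omega R)
  (xi : R -> Omega -> \bar R) (J : R -> Omega -> phase K).
Hypothesis hMAP : is_MAP P xi J.
Hypothesis hmono : nondecreasing_position xi.

Local Open Scope ereal_scope.

Definition riemann_limit h w := limn (fun m => (riemann h m (trajectory xi J w))%:E).

Lemma riemann_nondecreasing h w : (0 <= h)%R ->
  nondecreasing_seq (fun m => riemann h m (trajectory xi J w)).
Proof.
move=> h0; apply/nondecreasing_seqP => m; rewrite /riemann ler_wpM2l// big_ord_recr /=.
by rewrite lerDl discount_ge0.
Qed.

Lemma cvg_riemann h w : (0 <= h)%R ->
  (riemann h m (trajectory xi J w))%:E @[m --> \oo] --> riemann_limit h w.
Proof.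
move=> h0; apply: ereal_nondecreasing_is_cvgn => m n mn.
by rewrite lee_fin riemann_nondecreasing.
Qed.

Lemma riemann_le_limit h m w : (0 <= h)%R ->
  (riemann h m (trajectory xi J w))%:E <= riemann_limit h w.
Proof.
move=> h0; apply: lime_ge; first by apply/cvg_ex; eexists; exact: cvg_riemann.
by near=> n; rewrite lee_fin riemann_nondecreasing//; near: n; exists m.
Unshelve. all: by end_near. Qed.

Section fixed_trajectory.
Variable w : Omega.

Let f (t : R) := expeR (- xi t w).

Let fE t : (0 <= t)%R -> f t = (discount (xi t w))%:E.
Proof. by move=> t0; rewrite /f discount_expeR// (position_neqNy hMAP). Qed.

Let f0 t : 0 <= f t. Proof. exact: expeR_ge0. Qed.

Let mf (D : set R) : measurable D -> D `<=` `[0%R, +oo[ -> measurable_fun D f.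
Proof.
move=> mD D0; pose g (t : R) := discount (xi (Num.max t 0%R) w).
apply: (@eq_measurable_fun _ _ _ _ _ (EFin \o g)) => [t /[!inE] /D0|].
  by rewrite /= in_itv/= andbT => t0; rewrite fE// /g max_l.
apply/measurable_EFinP; apply: nonincreasing_measurable => // s t st.
apply: discount_le; first by rewrite (position_neqNy hMAP)// le_max lexx orbT.
apply: hmono; first by rewrite le_max lexx orbT.
by rewrite ge_max !le_max st lexx/= orbT.
Qed.

(* Bounds by the two end values, the integrand being nonincreasing. *)
Let slice (a b : R) : (0 <= a)%R -> (a <= b)%R ->
  ((b - a) * discount (xi b w))%:E <= \int[lebesgue_measure]_(t in `[a, b[) f t <=
  ((b - a) * discount (xi a w))%:E.
Proof.
move=> a0 ab.
have sub : `[a, b[ `<=` `[0%R, +oo[.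
  by move=> t /=; rewrite !in_itv/= => /andP[at_ _]; rewrite (le_trans a0).
have len (c : R) : \int[lebesgue_measure]_(t in `[a, b[) (cst c%:E t) = ((b - a) * c)%:E.
  rewrite integral_cst//= lebesgue_measure_itv/= lte_fin.
  case: ltP => [_|ba]; first by rewrite -EFinB -EFinM mulrC.
  have -> : b = a by apply/eqP; rewrite eq_le ab ba.
  by rewrite mule0 subrr mul0r.
rewrite -!len; apply/andP; split; apply: ge0_le_integral => //.
- by move=> t _; rewrite lee_fin discount_ge0.
- exact: mf.
- move=> t /=; rewrite in_itv/= => /andP[at_ tb]; rewrite fE ?(le_trans a0)//.
  rewrite lee_fin discount_le ?(position_neqNy hMAP) ?(le_trans a0)//.
  by apply: hmono; [exact: le_trans at_|exact: ltW].
- exact: mf.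
- move=> t /=; rewrite in_itv/= => /andP[at_ tb]; rewrite fE ?(le_trans a0)//.
  by rewrite lee_fin discount_le ?(position_neqNy hMAP)//; exact: hmono.
Qed.

Let partial (h : R) m := \int[lebesgue_measure]_(t in `[0%R, (m%:R * h)%R[) f t.

Let partialS h m : (0 < h)%R -> partial h m.+1 =
  partial h m + \int[lebesgue_measure]_(t in `[(m%:R * h)%R, (m.+1%:R * h)%R[) f t.
Proof.
move=> h0; rewrite /partial.
have m0 : (0 <= m%:R * h)%R by rewrite mulr_ge0// ltW.
have mS : (m%:R * h <= m.+1%:R * h)%R by rewrite ler_wpM2r ?ler_nat// ltW.
rewrite (@itv_bndbnd_setU _ _ (BLeft 0%R) (BLeft (m%:R * h)%R) (BLeft (m.+1%:R * h)%R))//.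
rewrite ge0_integral_setU//.
- apply: mf; first exact: measurableU.
  move=> t [] /=; rewrite !in_itv/= => /andP[a b]; rewrite ?a//.
  by rewrite (le_trans m0 a).
- apply/disj_setPS => t [] /=; rewrite !in_itv/= => /andP[_ +] /andP[+ _].
  by move=> /lt_le_trans /[apply]; rewrite ltxx.
Qed.

Let partial_le h m : (0 < h)%R -> partial h m <= (riemann h m (trajectory xi J w))%:E.
Proof.
move=> h0; elim: m => [|m IH].
  by rewrite /partial mul0r set_itvco0 integral_set0 lee_fin riemann_ge0// ltW.
rewrite partialS// /riemann big_ord_recr/= mulrDr EFinD leeD//.
have := slice (mulr_ge0 (ler0n _ m) (ltW h0)).
move=> /(_ (m.+1%:R * h)%R) /=.
rewrite ler_wpM2r ?ler_nat ?(ltW h0)// => /(_ isT) /andP[_].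
by rewrite -mulrBl -natrB// subSnn mul1r.
Qed.

Let partial_ge h m : (0 < h)%R ->
  (riemann h m.+1 (trajectory xi J w))%:E <= (h * discount (xi 0 w))%:E + partial h m.
Proof.
move=> h0; elim: m => [|m IH].
  rewrite /partial mul0r set_itvco0 integral_set0 adde0 lee_fin /riemann.
  by rewrite big_ord_recr big_ord0/= add0r mul0r.
rewrite partialS// addeA; apply: (@le_trans _ _
  ((riemann h m.+1 (trajectory xi J w))%:E + (h * discount (xi (m.+1%:R * h) w))%:E)).
  by rewrite -EFinD lee_fin {1}/riemann big_ord_recr/= mulrDr.
apply: leeD => //; have := slice (mulr_ge0 (ler0n _ m) (ltW h0)).
move=> /(_ (m.+1%:R * h)%R) /=.
rewrite ler_wpM2r ?ler_nat ?(ltW h0)// => /(_ isT) /andP[+ _].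
by rewrite -mulrBl -natrB// subSnn mul1r.
Qed.

Let cvg_partial h : (0 < h)%R -> partial h m @[m --> \oo] --> exp_functional xi w.
Proof.
move=> h0; rewrite /exp_functional.
have -> : `[0%R, +oo[%classic = \bigcup_m (`[0%R, (m%:R * h)%R[%classic : set R).
  apply/seteqP; split=> t /=; last by move=> [m _] /=; rewrite !in_itv/= => /andP[->].
  rewrite in_itv/= andbT => t0; exists (Num.trunc (t / h)).+1 => //=.
  by rewrite in_itv/= t0/= -ltr_pdivrMr// truncnS_gt.
apply: ge0_nondecreasing_set_cvg_integral => //.
- apply/nondecreasing_seqP => m; apply/subsetPset => t /=; rewrite !in_itv/=.
  by move=> /andP[-> /lt_le_trans]; apply; rewrite ler_wpM2r ?ler_nat// ltW.
- by move=> m; apply: mf => // t /=; rewrite !in_itv/= => /andP[->].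
Qed.

Lemma exp_functional_le_limit h : (0 < h)%R ->
  exp_functional xi w <= riemann_limit h w.
Proof.
move=> h0; rewrite -(cvg_lim _ (cvg_partial h0))//; apply: lime_le.
  by apply/cvg_ex; eexists; exact: cvg_partial h0.
by apply: nearW => m; apply: le_trans (partial_le _ h0) _; exact/riemann_le_limit/ltW.
Qed.

Lemma limit_le_exp_functional h : (0 < h)%R ->
  riemann_limit h w <= (h * discount (xi 0 w))%:E + exp_functional xi w.
Proof.
move=> h0; apply: lime_le; first by apply/cvg_ex; eexists; exact/cvg_riemann/ltW.
apply: nearW => m; apply: (@le_trans _ _ (riemann h m.+1 (trajectory xi J w))%:E).
  by rewrite lee_fin riemann_nondecreasing// ltW.
apply: le_trans (partial_ge _ h0) _; rewrite leeD2l//.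
apply: ge0_subset_integral => //; first exact: mf.
by move=> t /=; rewrite !in_itv/= => /andP[->].
Qed.

End fixed_trajectory.

Lemma exp_functional_ge0 w : 0 <= exp_functional xi w.
Proof. by apply: integral_ge0 => t _; exact: expeR_ge0. Qed.

Lemma measurable_riemann_limit h : (0 <= h)%R -> measurable_fun setT (riemann_limit h).
Proof.
move=> h0; apply: (emeasurable_fun_cvg (fun m w => (riemann h m (trajectory xi J w))%:E)).
- by move=> m; apply/measurable_EFinP; exact: (measurable_riemann_trajectory hMAP).
- by move=> w _; exact: cvg_riemann.
Qed.

(** Pointwise for every path, also for those not starting at 0: this is what
    makes the exponential functional measurable. *)
Lemma cvg_riemann_limit w :
  riemann_limit n.+1%:R^-1 w @[n --> \oo] --> exp_functional xi w.
Proof.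
have upper : (n.+1%:R^-1 * discount (xi 0 w))%:E + exp_functional xi w
    @[n --> \oo] --> exp_functional xi w.
  rewrite -[X in _ --> X]add0e; apply: cvgeD => //; last exact: cvg_cst.
  apply: cvg_EFin; first exact: nearW.
  exact: cvg_harmonicM.
apply: squeeze_cvge upper => //; last exact: (@cvg_cst _ (exp_functional xi w)).
apply: nearW => n; rewrite exp_functional_le_limit ?invr_gt0//.
by rewrite limit_le_exp_functional ?invr_gt0.
Qed.

Lemma measurable_exp_functional : measurable_fun setT (exp_functional xi).
Proof.
apply: (emeasurable_fun_cvg (fun n => riemann_limit n.+1%:R^-1)).
- by move=> n; exact: measurable_riemann_limit.
- by move=> w _; exact: cvg_riemann_limit.
Qed.

End exponential_functional.

(** * Moments of the Riemann sums and of the exponential functional *)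

Section ereal_powers.
Context {R : realType}.
Implicit Types x y : \bar R.
Local Open Scope ereal_scope.

Lemma expeS_yy k : (+oo : \bar R) ^+ k.+1 = +oo.
Proof. by elim: k => // k IH; rewrite expeS IH mulyy. Qed.

Lemma le_expe x y k : 0 <= x -> x <= y -> x ^+ k <= y ^+ k.
Proof.
move=> x0 xy; elim: k => [|k IH]; first by rewrite !expe0.
by rewrite !expeS lee_pmul// expe_ge0.
Qed.

Lemma cvg_expe (u : nat -> \bar R) l k : 0 <= l ->
  u @ \oo --> l -> (u n ^+ k) @[n --> \oo] --> l ^+ k.
Proof.
move=> l0 ul; elim: k => [|k IH].
  by rewrite expe0; under eq_fun do rewrite expe0; exact: cvg_cst.
rewrite expeS; under eq_fun do rewrite expeS.
apply: cvgeM => //; rewrite mule_defE; move: l0 => {ul IH}; case: l => [r| |]// l0.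
- by rewrite -EFin_expe /= !andbF.
- by rewrite expe_eq0/= andbF.
Qed.

(** Convexity in its crudest form, x + c <= 2 max(x, c); it dominates the moments
    of the Riemann sums by those of the exponential functional. *)
Lemma expe_add_le x (c : R) k : 0 <= x -> (0 <= c)%R ->
  (x + c%:E) ^+ k <= (2 ^+ k)%:E * (x ^+ k + (c ^+ k)%:E).
Proof.
move=> + c0; case: x => [r| |]//; rewrite ?lee_fin => r0; last first.
  case: k => [|k].
    by rewrite expr0 mul1e !expe0 expr0 -EFinD lee_fin lerDl.
  by rewrite !expeS_yy addye// gt0_muley ?leey// lte_fin.
rewrite -EFinD -!EFin_expe -EFinD -EFinM lee_fin.
pose m := Num.max r c.
have m0 : (0 <= m)%R by rewrite le_max r0.
apply: (@le_trans _ _ ((2 * m) ^+ k)%R).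
  rewrite lerXn2r ?nnegrE ?addr_ge0 ?mulr_ge0//.
  by rewrite mulr_natl mulr2n lerD// le_max lexx ?orbT.
rewrite exprMn ler_wpM2l ?exprn_ge0// /m; case: (leP r c) => _.
  by rewrite lerDr exprn_ge0.
by rewrite lerDl exprn_ge0.
Qed.

Lemma measurable_expe d (T : measurableType d) (f : T -> \bar R) k :
  measurable_fun setT f -> measurable_fun setT (fun w => f w ^+ k).
Proof.
move=> mf; elim: k => [|k IH].
  by under eq_fun do rewrite expe0; exact: measurable_cst.
by under eq_fun do rewrite expeS; exact: emeasurable_funM.
Qed.

End ereal_powers.

Section limit_moments.
Context {R : realType} {K : nat} {d : measure_display} {Omega : measurableType d}.
Variables (P : R -> 'I_K -> probability Omega R)
  (xi : R -> Omega -> \bar R) (J : R -> Omega -> phase K).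
Hypothesis hMAP : is_MAP P xi J.
Hypothesis hmono : nondecreasing_position xi.

Local Notation mom := (moment P xi J).
Local Open Scope ereal_scope.

Definition limit_moment h k i := \int[P 0%R i]_w riemann_limit xi J h w ^+ k.

Definition functional_moment k i := \int[P 0%R i]_w exp_functional xi w ^+ k.

Lemma riemann_limit_ge0 h w : (0 <= h)%R -> 0 <= riemann_limit xi J h w.
Proof.
move=> h0; apply: le_trans (riemann_le_limit xi J 0 w h0).
by rewrite lee_fin riemann_ge0.
Qed.

Lemma moment_nondecreasing h k i : (0 <= h)%R -> nondecreasing_seq (mom h ^~ k ^~ i).
Proof.
move=> h0 m n mn; apply: ge0_le_integral => //.
- by move=> w _; rewrite lee_fin exprn_ge0// riemann_ge0.
- apply/measurable_EFinP; apply: measurable_funX; exact: (measurable_riemann_trajectory hMAP).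
- apply/measurable_EFinP; apply: measurable_funX; exact: (measurable_riemann_trajectory hMAP).
move=> w _; rewrite lee_fin lerXn2r ?nnegrE ?riemann_ge0//.
exact: riemann_nondecreasing.
Qed.

Lemma cvg_moment h k i : (0 <= h)%R ->
  mom h m k i @[m --> \oo] --> limit_moment h k i.
Proof.
move=> h0; rewrite /limit_moment.
rewrite (eq_integral (fun w => limn (fun m => (riemann h m (trajectory xi J w) ^+ k)%:E))).
  apply: cvg_monotone_convergence => //.
  - move=> m; apply/measurable_EFinP; apply: measurable_funX.
    exact: (measurable_riemann_trajectory hMAP).
  - by move=> m w _; rewrite lee_fin exprn_ge0// riemann_ge0.
  - move=> w _ m n mn; rewrite lee_fin lerXn2r ?nnegrE ?riemann_ge0//.
    exact: riemann_nondecreasing.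
move=> w _; apply/esym/cvg_lim => //; under eq_fun do rewrite EFin_expe.
by apply: cvg_expe; [exact: riemann_limit_ge0|exact: cvg_riemann].
Qed.

Lemma moment_le_limit h m k i : (0 <= h)%R -> mom h m k i <= limit_moment h k i.
Proof.
move=> h0; rewrite -(cvg_lim _ (@cvg_moment h k i h0))//.
apply: lime_ge; first by apply/cvg_ex; eexists; exact: cvg_moment h0.
by near=> n; apply: moment_nondecreasing => //; near: n; exists m.
Unshelve. all: by end_near. Qed.

Let mI := measurable_exp_functional hMAP hmono.

Lemma functional_moment_ge0 k i : 0 <= functional_moment k i.
Proof. by apply: integral_ge0 => w _; rewrite expe_ge0// exp_functional_ge0. Qed.

Lemma functional_le_limit_moment h k i : (0 < h)%R ->
  functional_moment k i <= limit_moment h k i.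
Proof.
move=> h0; apply: ge0_le_integral => //.
- by move=> w _; rewrite expe_ge0// exp_functional_ge0.
- exact: measurable_expe.
- apply: measurable_expe; exact/(measurable_riemann_limit hMAP)/ltW.
move=> w _; apply: le_expe; first exact: exp_functional_ge0.
exact: (exp_functional_le_limit hMAP).
Qed.

Lemma ae_limit_le h k i : (0 < h)%R -> {ae P 0%R i, forall w,
  riemann_limit xi J h w ^+ k <=
  (2 ^+ k)%:E * (exp_functional xi w ^+ k + (h ^+ k)%:E)}.
Proof.
move=> h0; apply: (ae_start hMAP) => w xi0.
apply: le_trans (expe_add_le _ (exp_functional_ge0 xi w) (ltW h0)).
apply: le_expe; first exact/riemann_limit_ge0/ltW.
have := limit_le_exp_functional hMAP hmono w h0.
by rewrite xi0 -[X in discount X]/(0%:E) discount_fin oppr0 expR0 mulr1 addeC.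
Qed.

Lemma integral_bound (c : R) k i : (0 <= c)%R ->
  \int[P 0%R i]_w ((2 ^+ k)%:E * (exp_functional xi w ^+ k + c%:E)) =
  (2 ^+ k)%:E * (functional_moment k i + c%:E).
Proof.
move=> c0; rewrite ge0_integralZl//; last 2 first.
- by apply: emeasurable_funD => //; exact: measurable_expe.
- by move=> w _; rewrite adde_ge0// expe_ge0// exp_functional_ge0.
congr (_ * _); rewrite ge0_integralD//; last 2 first.
- by move=> w _; rewrite expe_ge0// exp_functional_ge0.
- exact: measurable_expe.
by rewrite integral_prob_cst.
Qed.

Lemma limit_le_functional_moment h k i : (0 < h)%R ->
  limit_moment h k i <= (2 ^+ k)%:E * (functional_moment k i + (h ^+ k)%:E).
Proof.
move=> h0; rewrite -integral_bound ?exprn_ge0 ?(ltW h0)//.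
apply: ae_ge0_le_integral => //.
- by move=> w _; rewrite expe_ge0// riemann_limit_ge0// ltW.
- apply: measurable_expe; exact/(measurable_riemann_limit hMAP)/ltW.
- move=> w _; rewrite mule_ge0 ?lee_fin ?exprn_ge0// adde_ge0 ?lee_fin ?exprn_ge0 ?(ltW h0)//.
  by rewrite expe_ge0// exp_functional_ge0.
- apply: emeasurable_funM => //; apply: emeasurable_funD => //; exact: measurable_expe.
by apply: filterS (ae_limit_le k i h0) => w + _.
Qed.

(** Dominated convergence, with the bound of [ae_limit_le] at h = 1. *)
Lemma cvg_limit_moment k i : functional_moment k i < +oo ->
  limit_moment n.+1%:R^-1 k i @[n --> \oo] --> functional_moment k i.
Proof.
move=> Nfin.
have h0 n : (0 < n.+1%:R^-1 :> R)%R by rewrite invr_gt0.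
pose g w := (2 ^+ k)%:E * (exp_functional xi w ^+ k + 1%:E).
have g0 w : 0 <= g w.
  by rewrite mule_ge0 ?lee_fin ?exprn_ge0// adde_ge0 ?lee_fin// expe_ge0// exp_functional_ge0.
have mg : measurable_fun setT g.
  by apply: emeasurable_funM => //; apply: emeasurable_funD => //; exact: measurable_expe.
have ig : (P 0%R i).-integrable setT g.
  apply/integrableP; split => //.
  under eq_integral do rewrite gee0_abs//.
  rewrite integral_bound//; apply: lte_mul_pinfty => //; rewrite ?lee_fin ?exprn_ge0//.
  by rewrite lte_add_pinfty// ltry.
have ptw : {ae P 0%R i, forall w, setT w ->
    riemann_limit xi J n.+1%:R^-1 w ^+ k @[n --> \oo] --> exp_functional xi w ^+ k}.
  apply: aeW => w _; apply: cvg_expe; first exact: exp_functional_ge0.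
  exact: (cvg_riemann_limit hMAP hmono).
have dom : {ae P 0%R i, forall w n, setT w ->
    `|riemann_limit xi J n.+1%:R^-1 w ^+ k| <= g w}.
  have := ae_foralln (fun n => ae_limit_le k i (h0 n)); apply: filterS => w H n _.
  rewrite gee0_abs; last by rewrite expe_ge0// riemann_limit_ge0// ltW.
  apply: le_trans (H n) _; rewrite lee_wpmul2l ?lee_fin ?exprn_ge0// leeD2l// lee_fin.
  by rewrite exprn_ile1 ?invr_ge0// invf_le1 ?ler1n.
have mlim n := measurable_expe k (measurable_riemann_limit hMAP (ltW (h0 n))).
by have [] := dominated_convergence measurableT mlim (measurable_expe k mI) ptw ig dom.
Qed.

End limit_moments.

(** * Products of inverses and their growth *)

Section inverse_products.
Context {R : realType} {n : nat}.

(** M^(-1) - M'^(-1) = M^(-1) (M' - M) M'^(-1) is a product of nonnegative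
    matrices. *)
Lemma Zmatrix_inv_antitone (M M' : 'M[R]_n) v v' :
  Zmatrix M -> dominated M v -> Zmatrix M' -> dominated M' v' ->
  (forall i j, M i j <= M' i j) -> forall i j, invmx M' i j <= invmx M i j.
Proof.
move=> MZ Mv M'Z M'v' MM' i j; rewrite -subr_ge0.
have -> : invmx M i j - invmx M' i j = (invmx M *m ((M' - M) *m invmx M')) i j.
  rewrite mulmxBl mulmxBr mulmxV ?(Zmatrix_unit M'Z M'v')// mulmx1.
  by rewrite mulKmx ?(Zmatrix_unit MZ Mv)// !mxE.
apply: mulmx_ge0; first exact: Zmatrix_inv_ge0 Mv.
apply: mulmx_ge0; last exact: Zmatrix_inv_ge0 M'v'.
by move=> a b; rewrite !mxE subr_ge0.
Qed.

Lemma cvg_nonincreasing_mx (B : nat -> 'M[R]_n) :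
  (forall k i j, 0 <= B k i j) ->
  (forall k i j, B k.+1 i j <= B k i j) -> cvgn B.
Proof.
move=> B0 Bdec; apply/cvg_ex.
exists (\matrix_(i, j) limn (fun k => B k i j)); apply: cvg_mx => i j; rewrite mxE.
apply: nonincreasing_is_cvgn; first exact/nonincreasing_seqP.
by exists 0 => _ [k _ <-].
Qed.

(** B(k) B(k-1) ... B(1) applied to the vector 1. *)
Definition inverse_product (B : nat -> 'M[R]_n) k : 'cV[R]_n :=
  (\prod_(l < k) B (k - l)%N) *m const_mx 1.

Lemma inverse_productS B k :
  inverse_product B k.+1 = B k.+1 *m inverse_product B k.
Proof. by rewrite /inverse_product big_ord_recl subn0 -mulmxA. Qed.

(** Past some index k0 the matrices a B(k) contract a strictly positive vector v
    by a factor theta < 1, and the vector reached at k0 is below a multiple of v. *)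
Lemma geometric_bound (B : nat -> 'M[R]_n) (L : 'M[R]_n) (a : R) :
  0 <= a -> (forall k i j, 0 <= B k.+1 i j) -> B @ \oo --> L ->
  a * spectral_radius L < 1 ->
  exists C theta k0, [/\ 0 <= theta < 1 & forall k i,
    a ^+ (k0 + k) * inverse_product B (k0 + k) i 0 <= C i * theta ^+ k].
Proof.
move=> a0 B0 BL aL.
have L0 i j : 0 <= L i j.
  have := cvg_mx_entry i j BL; rewrite -cvg_shiftS => H.
  rewrite -(cvg_lim _ H)//; apply: limr_ge; first by apply/cvg_ex; exists (L i j).
  by apply: nearW => k; exact: B0.
have [v [v0 Lv]] := subinvariant_vector a0 L0 aL.
have gap0 i : 0 < v i 0 - a * (L *m v) i 0 by rewrite subr_gt0.
have [e e0 ev] := exists_small_scale (fun i => v i 0) gap0.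
(* The cap 1/2 only ensures that theta is nonnegative. *)
pose theta := 1 - Num.min e (2^-1).
have th0 : 0 <= theta.
  by rewrite subr_ge0 ge_min invf_le1 ?ler1n ?orbT.
have th1 : theta < 1 by rewrite ltrBlDr ltrDl lt_min e0 invr_gt0/=.
have Lth i : a * (L *m v) i 0 < theta * v i 0.
  have : Num.min e (2^-1) * v i 0 <= e * v i 0 by rewrite ler_wpM2r ?(ltW (v0 i))// ge_min lexx.
  have := ev i; rewrite /theta mulrBl mul1r; lra.
have [k0 _ Bth] : \forall k \near \oo, forall i, a * (B k *m v) i 0 < theta * v i 0.
  apply: filter_forall => i.
  have : a * (B k *m v) i 0 @[k --> \oo] --> a * (L *m v) i 0.
    apply: cvgM; first exact: cvg_cst.
    by apply: cvg_mx_entry; apply: cvg_mulmx => //; exact: cvg_cst.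
  by move=> /cvgr_lt/(_ _ (Lth i)).
have W0 k i : 0 <= inverse_product B k i 0.
  elim: k i => [|k IH] i; first by rewrite /inverse_product big_ord0 mul1mx mxE.
  by rewrite inverse_productS mulmx_ge0// => j b; rewrite (ord1 b).
have [c c0 cW] := exists_small_scale (fun i => inverse_product B k0 i 0) v0.
exists (fun i => a ^+ k0 * (c^-1 * v i 0)), theta, k0; rewrite th0; split=> // k.
elim: k => [|k IH] i.
  rewrite addn0 expr0 mulr1 ler_wpM2l ?exprn_ge0//.
  by rewrite ler_pdivlMl// ltW.
rewrite addnS exprS inverse_productS -mulrA mulrCA [a * _]mulrC.
have Wle j : a ^+ (k0 + k) * inverse_product B (k0 + k) j 0 <=
    a ^+ k0 * c^-1 * theta ^+ k * v j 0.
  by apply: le_trans (IH j) _; rewrite le_eqVlt; apply/orP; left; apply/eqP; ring.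
have Bstep : a ^+ (k0 + k) * (B (k0 + k).+1 *m inverse_product B (k0 + k)) i 0 <=
   a ^+ k0 * c^-1 * theta ^+ k * (B (k0 + k).+1 *m v) i 0.
  rewrite !mxE !mulr_sumr; apply: ler_sum => j _.
  by rewrite mulrCA [leRHS]mulrCA ler_wpM2l.
rewrite mulrA; apply: le_trans (ler_wpM2r a0 Bstep) _.
have coef0 : 0 <= a ^+ k0 * c^-1 * theta ^+ k.
  by rewrite !mulr_ge0 ?exprn_ge0 ?invr_ge0// ltW.
have := ltW (Bth (k0 + k).+1 (leqW (leq_addr _ _)) i).
move=> /(ler_wpM2l coef0) H.
have -> : a ^+ k0 / c * theta ^+ k * (B (k0 + k).+1 *m v) i 0 * a =
  a ^+ k0 / c * theta ^+ k * (a * (B (k0 + k).+1 *m v) i 0) by ring.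
by apply: le_trans H _; rewrite exprS le_eqVlt; apply/orP; left; apply/eqP; ring.
Qed.

End inverse_products.

(** * Finiteness and recursion of the moments *)

Section recursion.
Context {R : realType} {K : nat} {d : measure_display} {Omega : measurableType d}.
Variables (P : R -> 'I_K -> probability Omega R)
  (xi : R -> Omega -> \bar R) (J : R -> Omega -> phase K)
  (Phi : nat -> 'M[R]_K) (G : nat -> R -> 'M[R]_K).
Hypothesis hMAP : is_MAP P xi J.
Hypothesis hmono : nondecreasing_position xi.
Hypothesis hG : discounted_semigroup P xi J Phi G.
Hypothesis Phi_dominated : forall k, (0 < k)%N -> dominated (Phi k) (const_mx 1).

Local Notation mom := (moment P xi J).
Local Notation lmom := (limit_moment P xi J).
Local Notation N := (functional_moment P xi).
Let PhiZ := bernstein_Zmatrix hG.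
Let G_ge0 := semigroup_ge0 hG.

(** Weight of the l-th moment in the recursion.  For l = 0 the term h^k comes
    from all paths, dead ones included, so the weight is the identity acting on
    the vector 1 of moments of order 0, and not the transition matrix G 0 h. *)
Definition transition (l : nat) (h : R) : 'M[R]_K := if l is 0 then 1%:M else G l h.

Definition vmoment h m k : 'cV[R]_K := \col_i fine (mom h m k i).
Definition vlimit h k : 'cV[R]_K := \col_i fine (lmom h k i).
Definition vfunctional k : 'cV[R]_K := \col_i fine (N k i).

Lemma transition_ge0 l h i j : 0 <= h -> 0 <= transition l h i j.
Proof. by case: l => [|l] h0; [rewrite mxE ler0n|exact: G_ge0]. Qed.

Lemma moment0 h m i : mom h m 0 i = 1%E.
Proof. by rewrite /moment; under eq_integral do rewrite expr0; exact: integral_prob_cst. Qed.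

Lemma moment_fin h m k i : 0 < h -> mom h m k i \is a fin_num.
Proof.
move=> h0; elim: m k i => [|m IH] k i.
  rewrite /moment /riemann.
  under eq_integral do rewrite big_ord0 mulr0.
  by rewrite integral_prob_cst.
rewrite (moment_rec hMAP hG)// fin_numD /=.
apply/sum_fin_numP => l _ _; rewrite fin_numM//.
by apply/sum_fin_numP => j _ _; rewrite fin_numM// IH.
Qed.

Lemma momentE h m k i : 0 < h -> mom h m k i = (vmoment h m k i 0)%:E.
Proof. by move=> h0; rewrite mxE fineK// moment_fin. Qed.

Lemma vmoment_rec h m k : 0 < h ->
  vmoment h m.+1 k = \sum_(l < k.+1) ('C(k, l)%:R * h ^+ (k - l)) *:
     (transition l h *m vmoment h m l).
Proof.
move=> h0; apply/colP => i; apply: EFin_inj; rewrite -momentE//.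
rewrite (moment_rec hMAP hG)//.
rewrite big_ord_recl mxE summxE EFinD; congr (_ + _)%E.
  by rewrite mxE bin0 subn0 mul1r mul1mx mxE moment0 mulr1.
rewrite -sumEFin; apply: eq_bigr => l _.
rewrite [in RHS]mxE [RHS]EFinM !lift0; congr (_ * _)%E.
rewrite mxE -sumEFin; apply: eq_bigr => j _.
by rewrite EFinM -momentE.
Qed.

(** With Phi(k) v = 1, the vector (1 - G(k, h)) v equals h 1 + O(h^2), which is
    positive for small h: this makes the maximum principle available for
    1 - G(k, h). *)
Lemma small_step k : (0 < k)%N -> exists2 e : R, 0 < e & forall h, 0 < h <= e ->
  exists v : 'cV[R]_K, (forall i, 0 < v i 0) /\
    (forall i, 0 < ((1%:M - G k h) *m v) i 0).
Proof.
move=> k0; have [C C0 HC] := semigroup_taylor hG k.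
have dom := Phi_dominated k0.
have Phiu := Zmatrix_unit (PhiZ k) dom.
pose v := invmx (Phi k) *m const_mx 1 : 'cV[R]_K.
have Phiv i : (Phi k *m v) i 0 = 1 by rewrite mulKVmx// mxE.
have v0 i : 0 <= v i 0.
  by apply: (Zmatrix_mono (PhiZ k) dom) => j; rewrite Phiv.
have vpos i : 0 < v i 0.
  rewrite lt_neqAle v0 andbT eq_sym; apply/eqP => vi.
  have := Phiv i; rewrite mxE (bigD1 i)//= vi mulr0 add0r => E.
  suff : 1 <= (0 : R) by rewrite ler10.
  rewrite -{}E; apply: sumr_le0 => j ji; rewrite mulr_le0_ge0//.
  by rewrite (PhiZ k)// eq_sym.
pose S := \sum_j v j 0.
have S0 : 0 <= S by rewrite sumr_ge0.
have D0 : 0 < 1 + C * S by rewrite ltr_pwDl// mulr_ge0.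
exists (2 * (1 + C * S))^-1; first by rewrite invr_gt0 mulr_gt0.
move=> h /andP[h0 he]; exists v; split=> // i.
have h1 : h * (2 * (1 + C * S)) <= 1.
  by rewrite -(@ler_pM2r _ (2 * (1 + C * S))^-1) ?invr_gt0 ?mulr_gt0//
     mulfK ?gt_eqF ?mulr_gt0// mul1r.
have CS0 : 0 <= C * S by rewrite mulr_ge0.
have hCS : h * (C * S) < 1 by nra.
have hle1 : h <= 1 by nra.
rewrite mulmxBl mul1mx [X in 0 < X]mxE [X in _ + X]mxE.
have -> : v i 0 = \sum_j (i == j)%:R * v j 0.
  rewrite (bigD1 i)//= eqxx mul1r big1 ?addr0// => j.
  by rewrite eq_sym => /negPf ->; rewrite mul0r.
rewrite [X in - X]mxE -sumrB.
apply: (@lt_le_trans _ _ (\sum_j (h * (Phi k i j * v j 0) - h ^+ 2 * C * v j 0))).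
  rewrite sumrB -!mulr_sumr -/S.
  have := Phiv i; rewrite mxE => ->; rewrite mulr1 subr_gt0 -mulrA expr2 -mulrA.
  by rewrite -[ltRHS]mulr1 ltr_pM2l.
apply: ler_sum => j _; have := HC h i j; rewrite (ltW h0) hle1 => /(_ isT).
rewrite ler_norml => /andP[_]; have := v0 j.
move: (G k h i j) (Phi k i j) (v j 0) ((i == j)%:R : R) => a b x y x0 H.
rewrite -mulrBl mulrA -mulrBl ler_wpM2r//; lra.
Qed.

Let oneG_Z k h : 0 <= h -> Zmatrix (1%:M - G k h).
Proof.
move=> h0 i j ij; rewrite !mxE (negPf ij) sub0r oppr_le0; exact: G_ge0.
Qed.

Let limit_fin_of h k i : 0 < h -> (N k i < +oo)%E -> lmom h k i \is a fin_num.
Proof.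
move=> h0 Nfin; rewrite ge0_fin_numE.
  apply: le_lt_trans (limit_le_functional_moment hMAP hmono k i h0) _.
  by apply: lte_mul_pinfty => //; rewrite ?lee_fin ?exprn_ge0// lte_add_pinfty ?ltry.
exact: le_trans (functional_moment_ge0 P xi k i)
  (functional_le_limit_moment hMAP hmono k i h0).
Qed.

Let vmoment_le_vlimit h m k i : 0 < h -> (N k i < +oo)%E ->
  vmoment h m k i 0 <= vlimit h k i 0.
Proof.
move=> h0 Nfin; rewrite -lee_fin -momentE// mxE fineK; last exact: limit_fin_of.
exact: (moment_le_limit hMAP _ _ _ (ltW h0)).
Qed.

(** Induction on k.  For a small step h, the moments x_m of order k of the first
    m terms are nondecreasing in m and satisfy x_(m+1) = b_m + G(k, h) x_m with
    b_m bounded by a vector b made of moments of lower order.  Thus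
    (1 - G(k, h)) x_m <= b, and the maximum principle bounds x_m by
    (1 - G(k, h))^(-1) b, uniformly in m. *)
Lemma functional_moment_fin k i : (N k i < +oo)%E.
Proof.
elim/ltn_ind: k i => -[|k] IH i.
  rewrite /functional_moment; under eq_integral do rewrite expe0.
  by rewrite integral_prob_cst ltry.
have [h h0 /(_ h)] := small_step (ltn0Sn k).
rewrite h0 lexx => /(_ isT)[v [v0 Gv]].
have dom := dominated_pos v0 Gv; have GZ := oneG_Z k.+1 (ltW h0).
pose b := \sum_(l < k.+1) ('C(k.+1, l)%:R * h ^+ (k.+1 - l)) *: (transition l h *m vlimit h l).
pose y := invmx (1%:M - G k.+1 h) *m b.
have xy m j : vmoment h m k.+1 j 0 <= y j 0.
  rewrite -subr_ge0; have -> : y j 0 - vmoment h m k.+1 j 0 = (y - vmoment h m k.+1) j 0.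
    by rewrite !mxE.
  apply: (Zmatrix_mono GZ dom) => {}j.
  rewrite mulmxBr mulKVmx ?(Zmatrix_unit GZ dom)// mulmxBl mul1mx.
  have := @vmoment_rec h m k.+1 h0; rewrite big_ord_recr/= binn subnn mulr1 scale1r.
  move=> /(congr1 (fun v : 'cV_K => v j 0)).
  have addE (a1 a2 : 'cV[R]_K) : (a1 + a2) j 0 = a1 j 0 + a2 j 0 by rewrite mxE.
  rewrite addE => E.
  have mono : vmoment h m k.+1 j 0 <= vmoment h m.+1 k.+1 j 0.
    rewrite -lee_fin -!momentE//.
    exact: (moment_nondecreasing hMAP k.+1 j (ltW h0)).
  have le_b : (\sum_(l < k.+1) ('C(k.+1, l)%:R * h ^+ (k.+1 - l)) *:
      (transition l h *m vmoment h m l)) j 0 <= b j 0.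
    rewrite /b !summxE; apply: ler_sum => l _; rewrite !mxE ler_wpM2l//.
      by rewrite mulr_ge0// exprn_ge0// ltW.
    apply: ler_sum => a _; rewrite ler_wpM2l//; first exact/transition_ge0/ltW.
    by apply: vmoment_le_vlimit => //; apply: IH.
  have -> (a1 a2 a3 : 'cV[R]_K) : (a1 - (a2 - a3)) j 0 = a1 j 0 - (a2 j 0 - a3 j 0).
    by rewrite !mxE.
  by rewrite E in mono; lra.
apply: (@le_lt_trans _ _ (y i 0)%:E); last exact: ltry.
apply: le_trans (functional_le_limit_moment hMAP hmono _ _ h0) _.
rewrite -(cvg_lim _ (@cvg_moment _ _ _ _ P xi J hMAP h k.+1 i (ltW h0)))//.
apply: lime_le.
  by apply/cvg_ex; eexists; exact: (@cvg_moment _ _ _ _ P xi J hMAP h k.+1 i (ltW h0)).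
by apply: nearW => m; rewrite momentE// lee_fin.
Qed.

Lemma limit_momentE h k i : 0 < h -> lmom h k i = (vlimit h k i 0)%:E.
Proof. by move=> h0; rewrite mxE fineK// limit_fin_of// functional_moment_fin. Qed.

Lemma functional_momentE k i : N k i = (vfunctional k i 0)%:E.
Proof.
rewrite mxE fineK// ge0_fin_numE ?functional_moment_fin//.
exact: functional_moment_ge0.
Qed.

Lemma cvg_vmoment h k : 0 < h -> vmoment h m k @[m --> \oo] --> vlimit h k.
Proof.
move=> h0; apply: cvg_mx => i j; rewrite (ord1 j).
under eq_cvg do rewrite mxE; apply: fine_cvg; rewrite -limit_momentE//.
exact: (@cvg_moment _ _ _ _ P xi J hMAP h k i (ltW h0)).
Qed.

Lemma cvg_vlimit k : vlimit n.+1%:R^-1 k @[n --> \oo] --> vfunctional k.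
Proof.
apply: cvg_mx => i j; rewrite (ord1 j).
under eq_cvg do rewrite mxE; apply: fine_cvg; rewrite -functional_momentE.
by apply: (cvg_limit_moment hMAP hmono); exact: functional_moment_fin.
Qed.

Lemma vlimit_rec h k : 0 < h ->
  vlimit h k = \sum_(l < k.+1) ('C(k, l)%:R * h ^+ (k - l)) *:
     (transition l h *m vlimit h l).
Proof.
move=> h0; have := @cvg_vmoment h k h0; rewrite -cvg_shiftS => H.
apply: (cvgn_unique H).
under eq_cvg do rewrite /= vmoment_rec//.
apply: cvg_sum_mx => l; apply: cvgZ; first exact: cvg_cst.
by apply: cvg_mulmx; [exact: cvg_cst|exact: cvg_vmoment].
Qed.

Lemma cvg_semigroup k : G k n.+1%:R^-1 @[n --> \oo] --> (1%:M : 'M[R]_K) /\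
  n.+1%:R *: (1%:M - G k n.+1%:R^-1) @[n --> \oo] --> Phi k.
Proof.
have [C C0 HC] := semigroup_taylor hG k.
have bound n i j : `|n.+1%:R *: (1%:M - G k n.+1%:R^-1) i j - Phi k i j| <= n.+1%:R^-1 * C.
  have h0 : 0 < n.+1%:R^-1 :> R by rewrite invr_gt0.
  have h1 : n.+1%:R^-1 <= 1 :> R by rewrite invf_le1 ?ler1n.
  have := HC _ i j; move=> /(_ n.+1%:R^-1); rewrite (ltW h0) h1 => /(_ isT) H.
  rewrite -(@ler_pM2l _ n.+1%:R^-1)// mulrA -expr2; apply: le_trans H.
  rewrite -[X in X * `|_|](@ger0_norm R) ?(ltW h0)// -normrM mulrBr.
  rewrite /GRing.scale/= mulrA mulVf ?mul1r// distrC !mxE.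
  by rewrite le_eqVlt; apply/orP; left; apply/eqP; congr `|_|; ring.
split; last first.
  apply: cvg_mx => i j; apply: (cvg_of_dist (C := C)) => n.
  by rewrite mxE; exact: bound.
apply: cvg_mx => i j; apply: (cvg_of_dist (C := `|Phi k i j| + C)) => n.
have h0 : 0 < n.+1%:R^-1 :> R by rewrite invr_gt0.
have h1 : n.+1%:R^-1 <= 1 :> R by rewrite invf_le1 ?ler1n.
have := HC n.+1%:R^-1 i j; rewrite (ltW h0) h1 => /(_ isT).
rewrite mxE; move: (G k _ i j) (Phi k i j) ((i == j)%:R : R) => a b x H.
have -> : a - x = (a - (x - n.+1%:R^-1 * b)) - n.+1%:R^-1 * b by ring.
rewrite (le_trans (ler_normB _ _))// mulrDr addrC lerD//.
  by rewrite normrM ger0_norm ?(ltW h0).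
apply: le_trans H _; rewrite expr2 -mulrA ler_piMl// mulr_ge0// ltW.
Qed.

(** The limit of [vlimit_rec] divided by h: on the left h^(-1) (1 - G(k+1, h))
    tends to Phi(k+1); on the right the terms carry h^(k-l), so that only l = k
    survives, with coefficient C(k+1, k) = k + 1. *)
Lemma vfunctional_rec k : Phi k.+1 *m vfunctional k.+1 = k.+1%:R *: vfunctional k.
Proof.
have [G1 GPhi] := cvg_semigroup k.+1.
have transition1 l : transition l n.+1%:R^-1 @[n --> \oo] --> (1%:M : 'M[R]_K).
  by case: l => [|l]; [exact: cvg_cst|have [] := cvg_semigroup l.+1].
have lhs := cvg_mulmx GPhi (@cvg_vlimit k.+1).
apply: (cvgn_unique lhs).
pose c n l : R := 'C(k.+1, l)%:R * n.+1%:R^-1 ^+ (k - l).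
under eq_cvg => n.
  rewrite -scalemxAl mulmxBl mul1mx {1}(vlimit_rec k.+1) ?invr_gt0//.
  rewrite big_ord_recr/= binn subnn mulr1 scale1r addrK scaler_sumr.
  rewrite (eq_bigr (fun l : 'I_k.+1 => c n l *: (transition l n.+1%:R^-1 *m vlimit n.+1%:R^-1 l))).
    over.
  move=> l _; rewrite scalerA; congr (_ *: _).
  rewrite /c subSn -1?ltnS// exprS [LHS]mulrCA; congr (_ * _).
  by rewrite mulrA divff ?mul1r.
have -> : k.+1%:R *: vfunctional k =
    \sum_(l < k.+1) (if l == k :> nat then k.+1%:R else 0) *: (1%:M *m vfunctional l).
  rewrite big_ord_recr/= eqxx mul1mx big1 ?add0r// => l _.
  by rewrite ltn_eqF// scale0r.
apply: cvg_sum_mx => l; apply: cvgZ; last first.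
  by apply: cvg_mulmx; [exact: transition1|exact: cvg_vlimit].
rewrite /c; case: eqP => [->|/eqP lk].
  rewrite subnn binSn; under eq_cvg do rewrite expr0 mulr1; exact: cvg_cst.
have kl : (0 < k - l)%N by rewrite subn_gt0 ltn_neqAle lk/= -ltnS ltn_ord.
rewrite -[X in _ --> X](mulr0 'C(k.+1, l)%:R); apply: cvgM; first exact: cvg_cst.
apply: (cvg_of_dist (C := 1)) => n; rewrite subr0 mulr1.
rewrite ger0_norm ?exprn_ge0 ?invr_ge0// -[leRHS]expr1.
by rewrite ler_wiXn2l ?invr_ge0// invf_le1 ?ler1n.
Qed.

Lemma vfunctionalE k :
  vfunctional k = k`!%:R *: inverse_product (fun l => invmx (Phi l)) k.
Proof.
elim: k => [|k IH].
  rewrite /inverse_product big_ord0 fact0 scale1r mul1mx; apply/colP => i.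
  rewrite !mxE /functional_moment; under eq_integral do rewrite expe0.
  by rewrite integral_prob_cst.
have Phiu := Zmatrix_unit (@PhiZ k.+1) (Phi_dominated (ltn0Sn k)).
rewrite -(mulKmx Phiu (vfunctional k.+1)) vfunctional_rec IH inverse_productS.
by rewrite scalerA -natrM -factS -scalemxAr.
Qed.

End recursion.

(** * Exponential moments as series of moments *)

Section exponential_series.
Context {R : realType}.

Lemma geometric_series_fin (u : nat -> R) (C theta : R) k0 :
  (forall k, 0 <= u k) -> 0 <= theta < 1 ->
  (forall k, u (k0 + k)%N <= C * theta ^+ k) ->
  (\sum_(0 <= k <oo) (u k)%:E < +oo)%E.
Proof.
move=> u0 /andP[th0 th1] uC.
have D0 : 0 < 1 - theta by rewrite subr_gt0.
have C0 : 0 <= C by have := uC 0; rewrite expr0 mulr1; exact: le_trans.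
have tail k : \sum_(0 <= l < k) u (k0 + l)%N <= C * (1 - theta ^+ k) / (1 - theta).
  elim: k => [|k IH]; first by rewrite big_geq// expr0 subrr mulr0 mul0r.
  rewrite big_nat_recr//=; apply: le_trans (lerD IH (uC k)) _.
  rewrite le_eqVlt; apply/orP; left; apply/eqP; rewrite exprS; field.
  by rewrite gt_eqF.
apply: (@le_lt_trans _ _ (\sum_(0 <= l < k0) u l + C / (1 - theta))%:E); last exact: ltry.
apply: lime_le; first by apply: is_cvg_nneseries => k _ _; rewrite lee_fin.
apply: nearW => k; rewrite sumEFin lee_fin.
apply: (@le_trans _ _ (\sum_(0 <= l < k0 + k) u l)).
  rewrite [leRHS](big_cat_nat (n := k)) ?leq_addl//=.
  by rewrite lerDl sumr_ge0.
rewrite (big_cat_nat (n := k0)) ?leq_addr//= lerD2l.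
rewrite -{1}[k0]add0n big_addn addKn.
under eq_bigr do rewrite addnC.
apply: le_trans (tail k) _; rewrite ler_wpM2r ?invr_ge0 ?(ltW D0)//.
by rewrite ler_piMr// lerBlDr lerDl exprn_ge0.
Qed.

Lemma expeR_series (a : R) (x : \bar R) : 0 < a -> (0 <= x)%E ->
  expeR (a%:E * x) = (\sum_(0 <= k <oo) ((a ^+ k / k`!%:R)%:E * x ^+ k))%E.
Proof.
move=> a0; case: x => [r r0| _|]//.
  rewrite -EFinM /= /expR -EFin_lim; last exact: is_cvg_series_exp_coeff.
  congr (limn _); apply/funext => m /=; rewrite /series /= -sumEFin.
  apply: eq_bigr => k _; rewrite -EFin_expe -EFinM /exp_coeff /= exprMn; congr (_%:E).
  by rewrite mulrAC.
rewrite gt0_muley ?lte_fin//=; apply/esym/eqP; rewrite -leye_eq.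
apply: le_trans (nneseries_lim_ge 2 _).
  rewrite big_nat_recr//= big_nat1 expe0 mule1 expr1 gt0_muley ?addey//.
  by rewrite lte_fin divr_gt0.
move=> k _ _; apply: mule_ge0; last exact: expe_ge0.
by rewrite lee_fin divr_ge0// exprn_ge0// ltW.
Qed.

End exponential_series.

Section exponential_moments.
Context {R : realType} {d : measure_display} {Omega : measurableType d}.
Variables (mu : probability Omega R) (X : Omega -> \bar R).
Hypothesis mX : measurable_fun setT X.
Hypothesis X0 : forall w, (0 <= X w)%E.

(** For a <= 0 the integrand is at most 1. *)
Lemma exp_moment_npos (a : R) : a <= 0 -> (\int[mu]_w expeR (a%:E * X w) < +oo)%E.
Proof.
move=> a0; pose y w := ((- a)%:E * X w)%E.
have y0 w : (0 <= y w)%E by rewrite mule_ge0// lee_fin oppr_ge0.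
rewrite (eq_integral (fun w => (discount (y w))%:E)); last first.
  move=> w _; rewrite -discount_expeR; last by case: (y w) (y0 w).
  by rewrite /y EFinN mulNe oppeK.
apply: (@le_lt_trans _ _ (\int[mu]_w (cst 1%:E w))%E).
  apply: ge0_le_integral => //.
  - by move=> w _; rewrite lee_fin discount_ge0.
  - apply/measurable_EFinP; apply: (measurableT_comp measurable_discount).
    exact: emeasurable_funM.
  move=> w _; rewrite lee_fin -[1]expR0 -oppr0 -discount_fin.
  exact: discount_le.
by rewrite integral_cst//= probability_setT mule1 ltry.
Qed.

Lemma exp_moment_series (a : R) : 0 < a ->
  (\int[mu]_w expeR (a%:E * X w) =
   \sum_(0 <= k <oo) (a ^+ k / k`!%:R)%:E * \int[mu]_w (X w ^+ k))%E.
Proof.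
move=> a0; under eq_integral do rewrite expeR_series//.
have c0 k : (0 <= (a ^+ k / k`!%:R)%:E)%E by rewrite lee_fin divr_ge0// exprn_ge0// ltW.
rewrite integral_nneseries//.
- apply: eq_eseriesr => k _; rewrite ge0_integralZl// => [|w _].
    exact: measurable_expe.
  exact: expe_ge0.
- by move=> k; apply: emeasurable_funM => //; exact: measurable_expe.
- by move=> k w _; rewrite mule_ge0// expe_ge0.
Qed.

End exponential_moments.

(** * Irreducibility, and the two statements on the exponential functional *)

Section bernstein.
Context {R : realType} {K : nat} (ch : characteristics R K).

Lemma jump_laplace_gt0 i j (p : R) : admissible ch -> 0 <= p -> 0 < jump_laplace ch i j p.
Proof.
move=> hadm p0; rewrite /jump_laplace /Rintegral.
set D : set (measurableTypeR R) := [set` `[0, +oo[].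
have mD : measurable D by exact: measurable_itv.
have f0 (x : R) : (0 <= (expR (- (p * x)))%:E)%E by rewrite lee_fin expR_ge0.
have mf : measurable_fun setT (fun x : measurableTypeR R => (expR (- (p * x)))%:E).
  apply/measurable_EFinP; apply: measurableT_comp => //.
  by apply: measurableT_comp => //; exact: measurable_funM.
have D1 : jump ch i j D = 1%E.
  have := probability_setC (jump ch i j) mD.
  rewrite (_ : ~` D = [set x : R | x < 0]); last first.
    apply/seteqP; split=> x; rewrite /D /= in_itv/= andbT ltNge; first by move/negP.
    by move=> /negP.
  rewrite jump_support// => /esym/eqP; rewrite sube_eq ?ge0_adde_def ?inE//.
    by rewrite add0e eq_sym => /eqP.
rewrite fine_gt0//; apply/andP; split; last first.
  apply: (@le_lt_trans _ _ (\int[jump ch i j]_(x in D) (cst 1%:E x))%E).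
    apply: ge0_le_integral => //; first exact: measurable_funS mf.
    move=> x; rewrite /D/= in_itv/= andbT => x0.
    by rewrite lee_fin -[leRHS]expR0 ler_expR oppr_le0 mulr_ge0.
  by rewrite integral_cst// mul1e (le_lt_trans (probability_le1 _ mD)) ?ltry.
rewrite lt_neqAle integral_ge0 ?andbT//; apply/eqP => /esym int0.
have : (\int[jump ch i j]_(x in D) `|(expR (- (p * x)))%:E| = 0)%E.
  by rewrite -[RHS]int0; apply: eq_integral => x _; rewrite gee0_abs.
move=> /(ae_eq_integral_abs (jump ch i j) mD (measurable_funS measurableT (@subsetT _ _) mf)).
move=> [N [mN N0 DN]].
have : (jump ch i j D <= jump ch i j N)%E.
  apply: le_measure; rewrite ?inE// => x Dx; apply: DN => /= /(_ Dx)/eqP.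
  by rewrite eqe gt_eqF// expR_gt0.
by rewrite D1 N0 lee_fin ler10.
Qed.

Lemma bernstein_offdiag i j (p : R) : i != j ->
  bernstein ch p i j = - (rate ch i j * jump_laplace ch i j p).
Proof. by move=> ij; rewrite /bernstein !mxE (negPf ij) mulr0n sub0r. Qed.

(** An edge with positive rate carries a positive jump Laplace transform, as the
    jump law is a probability on [0, +oo[. *)
Lemma irreducible_bernstein (p : R) : admissible ch -> irreducible_types ch -> 0 <= p ->
  forall i j, connect [rel a b | bernstein ch p a b < 0] i j.
Proof.
move=> hadm hirr p0 i j.
case/connectP: (hirr i j) => q; elim: q i => [|a q IH] i /=.
  by move=> _ ->; exact: connect0.
move=> /andP[ia aq] jq; have aj := IH _ aq jq.
have [ia'|ia'] := eqVneq i a; first by rewrite ia'.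
apply: connect_trans aj; apply: connect1 => /=.
by rewrite bernstein_offdiag// oppr_lt0 mulr_gt0// jump_laplace_gt0.
Qed.

End bernstein.

Section conclusion.
Context {R : realType} {K : nat} {d : measure_display} {Omega : measurableType d}.
Variables (P : R -> 'I_K -> probability Omega R)
  (xi : R -> Omega -> \bar R) (J : R -> Omega -> phase K)
  (Phi : nat -> 'M[R]_K) (G : nat -> R -> 'M[R]_K).
Hypothesis hMAP : is_MAP P xi J.
Hypothesis hmono : nondecreasing_position xi.
Hypothesis hG : discounted_semigroup P xi J Phi G.
Hypothesis irreducible : forall k i j, connect [rel a b | Phi k a b < 0] i j.
Hypothesis nonconstant : ~ as_constant_position P xi.

Let PhiZ := bernstein_Zmatrix hG.

Lemma bernstein_dominated k : (0 < k)%N -> dominated (Phi k) (const_mx 1).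
Proof.
move=> k0.
have row0 i := bernstein_row_ge0 hMAP hmono hG i k0.
split=> // i; first by rewrite mxE.
have /existsP[j j0] : [exists j, 0 < (Phi k *m (const_mx 1 : 'cV_K)) j 0].
  rewrite -[X in is_true X]negbK; apply/negP => /existsPn row_le0; apply: nonconstant.
  apply: (conservative_constant hMAP hmono hG k0).
  apply/colP => j; apply/eqP; rewrite [X in _ == X]mxE eq_le row0 andbT.
  by rewrite leNgt row_le0.
by exists j.
Qed.

Lemma bernstein_unit k : (0 < k)%N -> Phi k \in unitmx.
Proof. by move=> k0; exact: Zmatrix_unit (bernstein_dominated k0). Qed.

Lemma bernstein_inv_ge0 k i j : 0 <= invmx (Phi k.+1) i j.
Proof. exact: (Zmatrix_inv_ge0 (@PhiZ _) (bernstein_dominated (ltn0Sn k))). Qed.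

(** Entrywise monotone and bounded below by 0, from index 1 on. *)
Lemma cvg_bernstein_inv : cvgn (fun k => invmx (Phi k)).
Proof.
have : cvgn (fun k => invmx (Phi k.+1)).
  apply: cvg_nonincreasing_mx => [k i j|k i j]; first exact: bernstein_inv_ge0.
  apply: (Zmatrix_inv_antitone (@PhiZ _) (bernstein_dominated (ltn0Sn k)) (@PhiZ _)
    (bernstein_dominated (ltn0Sn k.+1))).
  by move=> {}i {}j; exact: (bernstein_mono hMAP hmono hG).
case/cvg_ex => l; rewrite (cvg_shiftS (fun k => invmx (Phi k))) => H.
by apply/cvg_ex; exists l.
Qed.

Lemma exp_functional_moment k i : (\int[P 0%R i]_w (exp_functional xi w ^+ k) =
  ((k`!%:R *: inverse_product (fun k => invmx (Phi k)) k) i 0)%:E)%E.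
Proof.
rewrite -[LHS]/(functional_moment P xi k i).
rewrite (functional_momentE hMAP hmono hG bernstein_dominated).
by rewrite (vfunctionalE hMAP hmono hG bernstein_dominated).
Qed.

Lemma exp_functional_exp_moment (a : R) i :
  a * spectral_radius (limn (fun k => invmx (Phi k))) < 1 ->
  (\int[P 0%R i]_w expeR (a%:E * exp_functional xi w) < +oo)%E.
Proof.
move=> aL.
have mI := measurable_exp_functional hMAP hmono.
have [a0|a0] := leP a 0.
  by apply: exp_moment_npos => // w; exact: exp_functional_ge0.
rewrite exp_moment_series//; last exact: exp_functional_ge0.
have [C [theta [k0 [th bound]]]] :=
  geometric_bound (ltW a0) bernstein_inv_ge0 cvg_bernstein_inv aL.
rewrite (eq_eseriesr (g := fun k =>
    (a ^+ k * inverse_product (fun k => invmx (Phi k)) k i 0)%:E)); last first.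
  move=> k _; rewrite exp_functional_moment mxE -EFinM; congr (_%:E).
  by rewrite mulrA divfK// pnatr_eq0 -lt0n fact_gt0.
apply: (geometric_series_fin _ th (bound ^~ i)) => k.
rewrite mulr_ge0 ?exprn_ge0 ?(ltW a0)//.
elim: k i => [|k IH] i; first by rewrite /inverse_product big_ord0 mul1mx mxE.
rewrite inverse_productS mulmx_ge0//; first exact: bernstein_inv_ge0.
by move=> j b; rewrite (ord1 b).
Qed.

End conclusion.

Theorem proposition1p8 (R : realType) (K : nat)
    (d : measure_display) (Omega : measurableType d)
    (P : R -> 'I_K -> probability Omega R)
    (xi : R -> Omega -> \bar R) (J : R -> Omega -> phase K)
    (ch : characteristics R K)
    (hMAP : is_MAP P xi J)
    (hmono : nondecreasing_position xi)
    (hadm : admissible ch)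
    (hch : has_characteristics P xi J ch)
    (hirr : irreducible_types ch)
    (hnc : ~ as_constant_position P xi) :
  let Phi := bernstein ch in
  let I := exp_functional xi in
  let L := limn (fun k : nat => invmx (Phi k%:R)) in
  [/\ (forall k : nat, (0 < k)%N -> Phi k%:R \in unitmx),
      (forall (k : nat) (i : 'I_K),
        (\int[P 0%R i]_w (I w ^+ k) =
         ((k`!%:R *: ((\prod_(l < k) invmx (Phi (k - l)%N%:R)) *m
                      (const_mx 1 : 'cV[R]_K))) i ord0)%:E)%E),
      cvgn (fun k : nat => invmx (Phi k%:R)) &
      (forall a : R, a * spectral_radius L < 1 ->
        forall i : 'I_K, (\int[P 0%R i]_w expeR (a%:E * I w) < +oo)%E)].
Proof.
move=> Phi I L.
pose G (k : nat) (t : R) : 'M[R]_K := expmx (- t *: Phi k%:R).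
have hG : discounted_semigroup P xi J (fun k => Phi k%:R) G.
  split=> [l t i j t0|l|l t v v0].
  - rewrite /G -hch//; apply: eq_integral => w /[!inE] Jt.
    have /fineK <- := position_fin hMAP t0 Jt.
    by rewrite -EFinM /= discount_fin -expRM_natl mulrN.
  - exact: expmx_taylor.
  - by apply: expmx_fix; rewrite -scalemxAl v0 scaler0.
have irr k : forall i j, connect [rel a b | Phi k%:R a b < 0] i j.
  exact: irreducible_bernstein.
split.
- exact: (bernstein_unit hMAP hmono hG irr hnc).
- exact: (exp_functional_moment hMAP hmono hG irr hnc).
- exact: (cvg_bernstein_inv hMAP hmono hG irr hnc).
- move=> a aL i.
  exact: (exp_functional_exp_moment hMAP hmono hG irr hnc).
Qed.
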